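(* Let $S$ be the curve $y(2x+y)(y+x^2)(y-x^2)=0$. Its local braid monodromy $\beta$ at $(0,0)$ is: the three points $y=1,0,-1$ of the fiber over $x=1$ do two counterclockwise generalized full-twists, and the fourth point $y=-2$ does a counterclockwise full-twist around them. That is, $\beta$ is the braid induced by the motion in which first $\{-1,0,1\}$ is rotated about $0$ by the angle $4\pi$ counterclockwise with $-2$ fixed, and then $-2$ makes one full counterclockwise revolution along the circle $|y|=2$ with $-1,0,1$ fixed. The induced relations are $$x_1x_4x_3x_2=x_4x_3x_2x_1,\qquad (x_4x_3x_2)^2x_1=x_3x_2x_4x_3x_2x_1x_4=x_2x_4x_3x_2x_1x_4x_3,$$ where $\{x_1,x_2,x_3,x_4\}$ are the generators of the standard g-base.
   Context: Let $E=\{x\in\mathbb{C}:|x|\le 1\}$, $D=\{y\in\mathbb{C}:|y|\le 4\}$, and regard $S$ as a curve in $E\times D$. The projection of $S$ to $E$ has fibers of constant cardinality $n$ ($n=4$ here) except over $x=0$. Let $K\subset D$ be the set of $y$-coordinates of the points of $S$ over $x=1$. A motion of $K$ in $D$ consists of $n$ continuous functions $m_i:[0,1]\to D$ with $m_i(t)\ne m_j(t)$ for all $t$ and $i\neq j$, and $\{m_i(0)\}=\{m_i(1)\}=K$. It is realized by a continuous family of diffeomorphisms $D_t$ of $D$, $D_0=\mathrm{Id}$, equal to the identity on $\partial D$, with $D_t(m_i(0))=m_i(t)$; the braid induced by the motion is the class of $D_1$ in the braid group $B_n[D,K]$, the group of diffeomorphisms of $D$ preserving $K$ and equal to the identity on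 $\partial D$, two being identified if they induce the same automorphism of $\pi_1(D-K,u_0)$. The local braid monodromy $\beta$ of $S$ at $(0,0)$ is the braid induced by the motion formed by the points of $S$ over $x=e^{2\pi i t}$, $0\le t\le 1$. Standard g-base: take the base point $u_0=-4i$ and let $p_1<\dots<p_n$ be the (real) points of $K$. The loop $x_i$ goes from $u_0$ along the straight segment to near $p_i$, once counterclockwise around $p_i$ on a small circle, and back. In a product of loops the left factor is traversed first. The group $\pi_1(D-K,u_0)$ is free on $x_1,\dots,x_n$. The relations induced by $\beta$ are $\beta(x_j)=x_j$, $j=1,\dots,n$. Saying that ''the induced relations are $R$'' means that $R$ and $\{\beta(x_j)=x_j\}_j$ have the same normal closure in the free group on $x_1,\dots,x_n$. *)

(* Defs.v *)
From HB Require Import structures.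
From mathcomp Require Import all_boot all_order all_algebra generic_quotient.
From mathcomp Require Import complex ring lra.
From mathcomp Require Import mathcomp_extra boolp classical_sets functions.
From mathcomp Require Import reals topology normedtype derive trigo.

Set Implicit Arguments.
Unset Strict Implicit.
Unset Printing Implicit Defensive.

Import Order.TTheory GRing.Theory Num.Theory.
Import numFieldNormedType.Exports.

Local Open Scope classical_set_scope.
Local Open Scope complex_scope.
Local Open Scope quotient_scope.
Local Open Scope ring_scope.

Section Gluing.
Variable R : realType.

Definition clamp (t : R) : R := Num.max 0 (Num.min 1 t).

Lemma clamp_itv t : 0 <= clamp t <= 1.
Proof.
by rewrite /clamp le_max lexx ge_max ler01 ge_min lexx.
Qed.

Lemma clamp_id t : 0 <= t <= 1 -> clamp t = t.
Proof. by move=> /andP[? ?]; rewrite /clamp min_r // max_r. Qed.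

Lemma continuous_clamp : continuous clamp.
Proof.
move=> t; apply: continuous_max; first exact: cvg_cst.
by apply: continuous_min; [exact: cvg_cst|exact: cvg_id].
Qed.

Lemma continuous_clamped (U : topologicalType) (k : U -> R) :
  continuous k -> continuous (clamp \o k).
Proof. by move=> ck u; apply: continuous_comp; [exact: ck|exact: continuous_clamp]. Qed.

Lemma within_comp (U V W : topologicalType) (A : set V) (f : V -> W)
    (g : U -> V) : {within A, continuous f} -> continuous g ->
  (forall u, A (g u)) -> continuous (f \o g).
Proof.
move=> /subspace_continuousP cf cg Ag u.
apply: cvg_comp (cf _ (Ag u)) => B /= nB.
have := cg u _ nB; rewrite /nbhs /=; apply: filterS => v; exact.
Qed.

Lemma continuous_paste (U V : topologicalType) (k : U -> R) (c : R)
    (f g : U -> V) : continuous k -> continuous f -> continuous g ->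
  (forall u, k u = c -> f u = g u) ->
  continuous (fun u => if k u <= c then f u else g u).
Proof.
move=> ck cf cg fg.
have := @withinU_continuous U V (k @^-1` [set t | t <= c])
  (k @^-1` [set t | c <= t]) (fun u => if k u <= c then f u else g u).
have -> : k @^-1` [set t | t <= c] `|` k @^-1` [set t | c <= t] = setT.
  by apply/seteqP; split=> // u _ /=; case: (leP (k u) c); [left|right; exact: ltW].
move=> h; rewrite continuous_subspace_setT in h *.
apply: h.
- by apply: closed_comp => [u _|]; [exact: ck|exact: closed_le].
- by apply: closed_comp => [u _|]; [exact: ck|exact: closed_ge].
- apply: (@subspace_eq_continuous _ _ _ f); last exact: continuous_subspaceT.
  by move=> u; rewrite inE /= /from_subspace => ->.
- apply: (@subspace_eq_continuous _ _ _ g); last exact: continuous_subspaceT.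
  move=> u; rewrite inE /= /from_subspace => cu; case: ifPn => // uc.
  by rewrite fg //; apply/eqP; rewrite eq_le uc.
Qed.

End Gluing.

Section FundamentalGroup.
Variables (R : realType) (T : topologicalType) (X : set T).

(* Paths are total functions on R of which only the restriction to [0, 1] is
   constrained; homotopy below identifies those agreeing on [0, 1]. *)
Record pathIn (x y : T) := PathIn {
  path_fun :> R -> T;
  path_cont : {within `[0, 1], continuous path_fun};
  path_sub : forall t, 0 <= t <= 1 -> X (path_fun t);
  path_src : path_fun 0 = x;
  path_tgt : path_fun 1 = y }.

HB.instance Definition _ x y := gen_eqMixin (pathIn x y).
HB.instance Definition _ x y := gen_choiceMixin (pathIn x y).

(* Homotopy relative to the endpoints; the first coordinate is the homotopy
   parameter. *)
Definition homotopic x y (f g : pathIn x y) : Prop :=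
  exists H : R * R -> T,
    [/\ {within `[0, 1] `*` `[0, 1], continuous H},
        forall s t, 0 <= s <= 1 -> 0 <= t <= 1 -> X (H (s, t)),
        forall t, 0 <= t <= 1 -> H (0, t) = f t /\ H (1, t) = g t &
        forall s, 0 <= s <= 1 -> H (s, 0) = x /\ H (s, 1) = y].

Lemma path_clamp_cont x y (f : pathIn x y) (U : topologicalType) (k : U -> R) :
  continuous k -> continuous (f \o (@clamp R \o k)).
Proof.
move=> ck; apply: within_comp (@path_cont _ _ f) _ _.
  exact: continuous_clamped.
by move=> u; rewrite /= in_itv /=; exact: clamp_itv.
Qed.

Lemma square_clamp_cont (H : R * R -> T) (U : topologicalType) (h k : U -> R) :
  {within `[0, 1] `*` `[0, 1], continuous H} -> continuous h -> continuous k ->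
  continuous (fun u => H (clamp (h u), clamp (k u))).
Proof.
move=> cH ch ck.
apply: (@within_comp _ _ _ _ H (fun u => (clamp (h u), clamp (k u))) cH).
  move=> u.
  exact: (cvg_pair (@continuous_clamped _ _ _ ch u) (@continuous_clamped _ _ _ ck u)).
by move=> u; split; rewrite /= in_itv /=; exact: clamp_itv.
Qed.

Lemma within_eq (U : topologicalType) (A : set U) (f g : U -> T) :
  continuous f -> (forall u, A u -> f u = g u) -> {within A, continuous g}.
Proof.
move=> cf fg; apply: (@subspace_eq_continuous _ _ _ f).
  by move=> u; rewrite inE; exact: fg.
exact: continuous_subspaceT.
Qed.

Lemma homotopic_intro x y (f g : pathIn x y) (H : R * R -> T) :
  continuous H ->
  (forall s t, 0 <= s <= 1 -> 0 <= t <= 1 -> X (H (s, t))) ->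
  (forall t, 0 <= t <= 1 -> H (0, t) = f t /\ H (1, t) = g t) ->
  (forall s, 0 <= s <= 1 -> H (s, 0) = x /\ H (s, 1) = y) ->
  homotopic f g.
Proof. by move=> cH XH H01 Hs; exists H; split=> //; exact: continuous_subspaceT. Qed.

Lemma cont_fst : continuous (@fst R R). Proof. by move=> p; exact: cvg_fst. Qed.
Lemma cont_snd : continuous (@snd R R). Proof. by move=> p; exact: cvg_snd. Qed.

Lemma homotopic_refl x y (f : pathIn x y) : homotopic f f.
Proof.
apply: (@homotopic_intro _ _ f f (fun p => f (clamp p.2))).
- exact: path_clamp_cont cont_snd.
- by move=> s t _ ht; apply: path_sub; exact: clamp_itv.
- by move=> t ht; rewrite /= clamp_id.
- by move=> s _; rewrite /= !clamp_id ?lexx ?ler01 // path_src path_tgt.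
Qed.

Lemma homotopic_ext x y (f g : pathIn x y) :
  (forall t, 0 <= t <= 1 -> f t = g t) -> homotopic f g.
Proof.
move=> fg; have [H [cH XH H01 Hs]] := homotopic_refl f; exists H; split=> // t ht.
by rewrite -fg //; exact: H01.
Qed.

Lemma homotopic_sym x y (f g : pathIn x y) : homotopic f g -> homotopic g f.
Proof.
move=> [H [cH XH H01 Hs]].
apply: (@homotopic_intro _ _ g f (fun p => H (clamp (1 - p.1), clamp p.2))).
- apply: square_clamp_cont cont_snd => // p.
  by apply: cvgB; [exact: cvg_cst|exact: cvg_fst].
- by move=> s t _ _; apply: XH; exact: clamp_itv.
- move=> t ht; rewrite /= (clamp_id ht) subr0 subrr !clamp_id ?lexx ?ler01 //.
  by have [] := H01 t ht.
- move=> s hs; rewrite /= !(@clamp_id _ 0) ?(@clamp_id _ 1) ?lexx ?ler01 //.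
  by apply: Hs; exact: clamp_itv.
Qed.

Lemma affine_cont (U : topologicalType) (k : U -> R) (a b : R) :
  continuous k -> continuous (fun u => a * k u + b).
Proof.
move=> ck u; apply: cvgD; last exact: cvg_cst.
by apply: cvgM; [exact: cvg_cst|exact: ck].
Qed.

Lemma homotopic_trans x y (f g h : pathIn x y) :
  homotopic f g -> homotopic g h -> homotopic f h.
Proof.
move=> [H [cH XH H01 Hs]] [G [cG XG G01 Gs]].
apply: (@homotopic_intro _ _ f h (fun p => if p.1 <= 2^-1
  then H (clamp (2 * p.1 + 0), clamp p.2)
  else G (clamp (2 * p.1 + (-1)), clamp p.2))).
- apply: continuous_paste cont_fst _ _ _.
  + by apply: square_clamp_cont cont_snd => //; exact: affine_cont cont_fst.
  + by apply: square_clamp_cont cont_snd => //; exact: affine_cont cont_fst.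
  + move=> p ->; rewrite divff ?pnatr_eq0 // addr0 subrr.
    rewrite !(@clamp_id _ 0) ?(@clamp_id _ 1) ?lexx ?ler01 //.
    have [_ ->] := H01 (clamp p.2) (clamp_itv _).
    by have [-> _] := G01 (clamp p.2) (clamp_itv _).
- move=> s t _ _ /=; case: ifP => _; [apply: XH|apply: XG]; exact: clamp_itv.
- move=> t ht /=; rewrite (clamp_id ht) invr_ge0 ler0n.
  rewrite mulr0 addr0 clamp_id ?lexx ?ler01 //.
  rewrite ifF; last by apply/negbTE; rewrite -ltNge; lra.
  have -> : 2 * 1 + -1 = 1 :> R by lra.
  rewrite clamp_id ?lexx ?ler01 //.
  by split; [have [] := H01 t ht|have [] := G01 t ht].
- move=> s hs /=; rewrite !(@clamp_id _ 0) ?(@clamp_id _ 1) ?lexx ?ler01 //.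
  by case: ifP => _; [apply: Hs|apply: Gs]; exact: clamp_itv.
Qed.

(* In a product the left factor is traversed first. *)
Definition cat_fun (f g : R -> T) (t : R) : T :=
  if t <= 2^-1 then f (2 * t) else g (2 * t - 1).

Lemma cat_funE x y z (f : pathIn x y) (g : pathIn y z) t : 0 <= t <= 1 ->
  (if t <= 2^-1 then f (clamp (2 * t + 0)) else g (clamp (2 * t + (-1))))
  = cat_fun f g t.
Proof.
move=> ht; rewrite /cat_fun; case: (leP t 2^-1) => h.
  by rewrite addr0 clamp_id //; lra.
by rewrite clamp_id //; lra.
Qed.

Lemma cat_cont x y z (f : pathIn x y) (g : pathIn y z) :
  {within `[0, 1], continuous (cat_fun f g)}.
Proof.
apply: (@within_eq R _ (fun t => if t <= 2^-1 then f (clamp (2 * t + 0))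
   else g (clamp (2 * t + (-1))))); last first.
  by move=> t /=; rewrite in_itv; exact: cat_funE.
apply: (@continuous_paste _ _ _ id) => //.
- by move=> t; exact: cvg_id.
- by apply: path_clamp_cont; apply: affine_cont => t; exact: cvg_id.
- by apply: path_clamp_cont; apply: affine_cont => t; exact: cvg_id.
- move=> t ->; rewrite divff ?pnatr_eq0 // addr0 subrr.
  by rewrite !clamp_id ?lexx ?ler01 // path_src path_tgt.
Qed.

Lemma cat_sub x y z (f : pathIn x y) (g : pathIn y z) t : 0 <= t <= 1 ->
  X (cat_fun f g t).
Proof.
by move=> ht; rewrite -cat_funE //; case: ifP => _; apply: path_sub; exact: clamp_itv.
Qed.

Lemma cat_src x y z (f : pathIn x y) (g : pathIn y z) : cat_fun f g 0 = x.
Proof. by rewrite /cat_fun invr_ge0 ler0n mulr0 path_src. Qed.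

Lemma cat_tgt x y z (f : pathIn x y) (g : pathIn y z) : cat_fun f g 1 = z.
Proof.
rewrite /cat_fun ifF; last by apply/negbTE; rewrite -ltNge; lra.
have -> : 2 * 1 - 1 = 1 :> R by lra.
exact: path_tgt.
Qed.

Definition path_cat x y z (f : pathIn x y) (g : pathIn y z) : pathIn x z :=
  PathIn (@cat_cont _ _ _ f g) (@cat_sub _ _ _ f g) (cat_src f g) (cat_tgt f g).

Lemma rev_cont x y (f : pathIn x y) :
  {within `[0, 1], continuous (fun t => f (1 - t))}.
Proof.
apply: (@within_eq R _ (fun t => f (clamp (-1 * t + 1)))).
  by apply: path_clamp_cont; apply: affine_cont => t; exact: cvg_id.
move=> t /=; rewrite in_itv /= => ht.
by rewrite clamp_id; [congr (f _); lra|lra].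
Qed.

Lemma rev_sub x y (f : pathIn x y) t : 0 <= t <= 1 -> X (f (1 - t)).
Proof. by move=> ht; apply: path_sub; lra. Qed.

Lemma rev_src x y (f : pathIn x y) : f (1 - 0) = y.
Proof. by rewrite subr0 path_tgt. Qed.

Lemma rev_tgt x y (f : pathIn x y) : f (1 - 1) = x.
Proof. by rewrite subrr path_src. Qed.

Definition path_rev x y (f : pathIn x y) : pathIn y x :=
  PathIn (@rev_cont _ _ f) (@rev_sub _ _ f) (rev_src f) (rev_tgt f).

Lemma cst_path_cont (x : T) : {within `[0, 1], continuous (fun _ : R => x)}.
Proof. by apply: continuous_subspaceT => t; exact: cvg_cst. Qed.

Definition path_cst x (hx : X x) : pathIn x x :=
  PathIn (@cst_path_cont x) (fun _ _ => hx) erefl erefl.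

Lemma homotopic_cat x y z (f f' : pathIn x y) (g g' : pathIn y z) :
  homotopic f f' -> homotopic g g' ->
  homotopic (path_cat f g) (path_cat f' g').
Proof.
move=> [H [cH XH H01 Hs]] [G [cG XG G01 Gs]].
apply: (@homotopic_intro _ _ _ _ (fun p => if p.2 <= 2^-1
  then H (clamp p.1, clamp (2 * p.2 + 0))
  else G (clamp p.1, clamp (2 * p.2 + (-1))))).
- apply: continuous_paste cont_snd _ _ _.
  + by apply: square_clamp_cont cont_fst _ => //; exact: affine_cont cont_snd.
  + by apply: square_clamp_cont cont_fst _ => //; exact: affine_cont cont_snd.
  + move=> p ->; rewrite divff ?pnatr_eq0 // addr0 subrr.
    rewrite !(@clamp_id _ 0) ?(@clamp_id _ 1) ?lexx ?ler01 ?clamp_itv //.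
    have [_ ->] := Hs (clamp p.1) (clamp_itv _).
    by have [-> _] := Gs (clamp p.1) (clamp_itv _).
- move=> s t _ _ /=; case: ifP => _; [apply: XH|apply: XG]; exact: clamp_itv.
- move=> t ht /=; rewrite -!cat_funE //.
  rewrite !(@clamp_id _ 0) ?(@clamp_id _ 1) ?lexx ?ler01 //.
  by case: ifP => _; [apply: H01|apply: G01]; exact: clamp_itv.
- move=> s hs /=; rewrite invr_ge0 ler0n mulr0 addr0.
  rewrite ifF; last by apply/negbTE; rewrite -ltNge; lra.
  have -> : 2 * 1 + -1 = 1 :> R by lra.
  rewrite (clamp_id hs) !(@clamp_id _ 0) ?(@clamp_id _ 1) ?lexx ?ler01 //.
  by have [-> _] := Hs s hs; have [_ ->] := Gs s hs.
Qed.

Lemma homotopic_rev x y (f g : pathIn x y) :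
  homotopic f g -> homotopic (path_rev f) (path_rev g).
Proof.
move=> [H [cH XH H01 Hs]].
apply: (@homotopic_intro _ _ _ _ (fun p => H (clamp p.1, clamp (-1 * p.2 + 1)))).
- by apply: square_clamp_cont cont_fst _ => //; exact: affine_cont cont_snd.
- by move=> s t _ _; apply: XH; exact: clamp_itv.
- move=> t ht /=; have -> : -1 * t + 1 = 1 - t :> R by lra.
  rewrite !(@clamp_id _ 0) ?(@clamp_id _ 1) ?(@clamp_id _ (1 - t)) ?lexx ?ler01 //; last by lra.
  by apply: H01; lra.
- move=> s hs /=; rewrite mulr0 add0r mulr1 addNr (clamp_id hs).
  rewrite !(@clamp_id _ 0) ?(@clamp_id _ 1) ?lexx ?ler01 //.
  by have [] := Hs s hs.
Qed.

Lemma homotopic_reparam x y (f : pathIn x y) a b (g h : pathIn a b)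
    (u v : R -> R) : continuous u -> continuous v ->
  clamp (u 0) = clamp (v 0) -> clamp (u 1) = clamp (v 1) ->
  (forall t, 0 <= t <= 1 -> g t = f (clamp (u t))) ->
  (forall t, 0 <= t <= 1 -> h t = f (clamp (v t))) ->
  homotopic g h.
Proof.
move=> cu cv uv0 uv1 gE hE.
pose k (p : R * R) := clamp (u p.2) + p.1 * (clamp (v p.2) - clamp (u p.2)).
have ccu : continuous (fun p : R * R => clamp (u p.2)).
  apply: (@continuous_clamped _ _ (fun p : R * R => u p.2)) => p.
  by apply: continuous_comp; [exact: cont_snd|exact: cu].
have ccv : continuous (fun p : R * R => clamp (v p.2)).
  apply: (@continuous_clamped _ _ (fun p : R * R => v p.2)) => p.
  by apply: continuous_comp; [exact: cont_snd|exact: cv].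
have ck : continuous k.
  move=> p; apply: cvgD; first exact: ccu.
  apply: cvgM; first exact: cvg_fst.
  by apply: cvgB; [exact: ccv|exact: ccu].
have cc t : clamp (clamp t) = clamp t :> R by rewrite clamp_id ?clamp_itv.
apply: (@homotopic_intro _ _ _ _ (fun p => f (clamp (k p)))).
- exact: path_clamp_cont.
- by move=> s t _ _; apply: path_sub; exact: clamp_itv.
- by move=> t ht; rewrite gE // hE // /k /= mul0r addr0 mul1r addrC subrK !cc.
- move=> s hs; rewrite /k /= -uv0 -uv1 !subrr mulr0 !addr0 !cc -gE ?lexx ?ler01 //.
  by rewrite -gE ?lexx ?ler01 // path_src path_tgt.
Qed.

Lemma cont_id : continuous (@id R). Proof. by move=> t; exact: cvg_id. Qed.

Lemma homotopic_catA x y z w (f : pathIn x y) (g : pathIn y z) (h : pathIn z w) :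
  homotopic (path_cat f (path_cat g h)) (path_cat (path_cat f g) h).
Proof.
pose v (t : R) : R := if t <= 4^-1 then 2 * t + 0 else
  if t <= 2^-1 then 1 * t + 4^-1 else 2^-1 * t + 2^-1.
apply: (@homotopic_reparam _ _ (path_cat f (path_cat g h)) _ _ _ _ id v).
- exact: cont_id.
- apply: (@continuous_paste _ _ _ id); [exact: cont_id|exact: affine_cont cont_id| |].
    apply: (@continuous_paste _ _ _ id); [exact: cont_id|exact: affine_cont cont_id| |].
      exact: affine_cont cont_id.
    by move=> t ->; lra.
  by move=> t ->; rewrite ifT; lra.
- by rewrite /v ifT ?mulr0 ?addr0 // invr_ge0 ler0n.
- rewrite /v ifF; last by apply/negbTE; rewrite -ltNge; lra.
  rewrite ifF; last by apply/negbTE; rewrite -ltNge; lra.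
  by congr clamp; lra.
- by move=> t ht; rewrite clamp_id.
- move=> t ht; rewrite clamp_id; last first.
    by rewrite /v; case: (leP t 4^-1) => ?; [|case: (leP t 2^-1) => ?]; lra.
  rewrite /= /cat_fun /v.
  case: (leP t 4^-1) => t4.
    rewrite !ifT; [congr (f _); lra|lra|lra|lra].
  case: (leP t 2^-1) => t2.
    rewrite ifF; last by apply/negbTE; rewrite -ltNge; lra.
    rewrite ifF; last by apply/negbTE; rewrite -ltNge; lra.
    rewrite ifT; [congr (g _); lra|lra].
  rewrite ifF; last by apply/negbTE; rewrite -ltNge; lra.
  rewrite ifF; last by apply/negbTE; rewrite -ltNge; lra.
  congr (h _); lra.
Qed.

Lemma homotopic_cst_cat x y (hx : X x) (f : pathIn x y) :
  homotopic (path_cat (path_cst hx) f) f.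
Proof.
apply: (@homotopic_reparam _ _ f _ _ _ _ (fun t => 2 * t + (-1)) id).
- exact: affine_cont cont_id.
- exact: cont_id.
- by rewrite /clamp !max_l // ge_min; apply/orP; right; lra.
- by congr clamp; lra.
- move=> t ht /=; rewrite /cat_fun; case: (leP t 2^-1) => h.
    rewrite /clamp max_l; first by rewrite path_src.
    by rewrite ge_min; apply/orP; right; lra.
  by rewrite clamp_id //; lra.
- by move=> t ht; rewrite clamp_id.
Qed.

Lemma homotopic_cat_cst x y (hy : X y) (f : pathIn x y) :
  homotopic (path_cat f (path_cst hy)) f.
Proof.
apply: (@homotopic_reparam _ _ f _ _ _ _ (fun t => 2 * t + 0) id).
- exact: affine_cont cont_id.
- exact: cont_id.
- by rewrite mulr0 addr0.
- by rewrite /clamp !min_l //; lra.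
- move=> t ht /=; rewrite /cat_fun; case: (leP t 2^-1) => h.
    by rewrite clamp_id ?addr0 //; lra.
  by rewrite /clamp min_l ?max_r // ?path_tgt //; lra.
- by move=> t ht; rewrite clamp_id.
Qed.

Lemma homotopic_cat_rev x y (hx : X x) (f : pathIn x y) :
  homotopic (path_cat f (path_rev f)) (path_cst hx).
Proof.
pose u (t : R) : R := if t <= 2^-1 then 2 * t + 0 else (- 2) * t + 2.
apply: (@homotopic_reparam _ _ f _ _ _ _ u (fun => 0)).
- apply: (@continuous_paste _ _ _ id); [exact: cont_id|exact: affine_cont cont_id| |].
    exact: affine_cont cont_id.
  by move=> t ->; lra.
- by move=> t; exact: cvg_cst.
- by rewrite /u ifT ?mulr0 ?addr0 // invr_ge0 ler0n.
- rewrite /u ifF; last by apply/negbTE; rewrite -ltNge; lra.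
  by congr clamp; lra.
- move=> t ht /=; rewrite /cat_fun /u; case: (leP t 2^-1) => h.
    by rewrite clamp_id ?addr0 //; lra.
  by rewrite clamp_id; [congr (f _); lra|lra].
- by move=> t ht; rewrite clamp_id ?lexx ?ler01 //= path_src.
Qed.

Lemma homotopic_rev_cat x y (hy : X y) (f : pathIn x y) :
  homotopic (path_cat (path_rev f) f) (path_cst hy).
Proof.
pose u (t : R) : R := if t <= 2^-1 then (- 2) * t + 1 else 2 * t + (-1).
apply: (@homotopic_reparam _ _ f _ _ _ _ u (fun => 1)).
- apply: (@continuous_paste _ _ _ id); [exact: cont_id|exact: affine_cont cont_id| |].
    exact: affine_cont cont_id.
  by move=> t ->; lra.
- by move=> t; exact: cvg_cst.
- by rewrite /u ifT ?mulr0 ?add0r // invr_ge0 ler0n.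
- rewrite /u ifF; last by apply/negbTE; rewrite -ltNge; lra.
  by congr clamp; lra.
- move=> t ht /=; rewrite /cat_fun /u; case: (leP t 2^-1) => h.
    by rewrite clamp_id; [congr (f _); lra|lra].
  by rewrite clamp_id //; lra.
- by move=> t ht; rewrite clamp_id ?lexx ?ler01 //= path_tgt.
Qed.

Lemma homotopicb_refl x y : reflexive (fun f g : pathIn x y => `[< homotopic f g >]).
Proof. by move=> f; apply/asboolP; exact: homotopic_refl. Qed.

Lemma homotopicb_sym x y : symmetric (fun f g : pathIn x y => `[< homotopic f g >]).
Proof.
by move=> f g; apply/asboolP/asboolP; exact: homotopic_sym.
Qed.

Lemma homotopicb_trans x y : transitive (fun f g : pathIn x y => `[< homotopic f g >]).
Proof.
move=> g f h /asboolP fg /asboolP gh; apply/asboolP.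
exact: homotopic_trans fg gh.
Qed.

Canonical homotopic_equiv x y :=
  EquivRel _ (@homotopicb_refl x y) (@homotopicb_sym x y) (@homotopicb_trans x y).

(* The membership proof [hx] is an argument because it is needed for the
   constant loop. *)
Definition pi1 (x : T) (hx : X x) := {eq_quot (homotopic_equiv x x)}.

HB.instance Definition _ x (hx : X x) := Choice.on (pi1 hx).

Section Pi1Group.
Variables (x : T) (hx : X x).

Definition pi1_class (f : pathIn x x) : pi1 hx :=
  \pi_({eq_quot (homotopic_equiv x x)}) f.

Definition pi1_repr (a : pi1 hx) : pathIn x x :=
  repr (a : {eq_quot (homotopic_equiv x x)}).

Lemma pi1_reprK a : pi1_class (pi1_repr a) = a.
Proof. exact: reprK. Qed.

Lemma pi1_classP f g : pi1_class f = pi1_class g <-> homotopic f g.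
Proof.
split=> [/eqmodP /= /asboolP //|fg].
by apply/eqmodP => /=; apply/asboolP.
Qed.

Lemma pi1_repr_class f : homotopic (pi1_repr (pi1_class f)) f.
Proof. by apply/pi1_classP; exact: pi1_reprK. Qed.

Definition pi1_mul (a b : pi1 hx) := pi1_class (path_cat (pi1_repr a) (pi1_repr b)).
Definition pi1_inv (a : pi1 hx) := pi1_class (path_rev (pi1_repr a)).
Definition pi1_one : pi1 hx := pi1_class (path_cst hx).

Lemma pi1_mulE f g :
  pi1_mul (pi1_class f) (pi1_class g) = pi1_class (path_cat f g).
Proof. by apply/pi1_classP; apply: homotopic_cat; exact: pi1_repr_class. Qed.

Lemma pi1_invE f : pi1_inv (pi1_class f) = pi1_class (path_rev f).
Proof. by apply/pi1_classP; apply: homotopic_rev; exact: pi1_repr_class. Qed.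

Lemma pi1_mulA : associative pi1_mul.
Proof.
move=> a b c; rewrite -(pi1_reprK a) -(pi1_reprK b) -(pi1_reprK c) !pi1_mulE.
by apply/pi1_classP; exact: homotopic_catA.
Qed.

Lemma pi1_mul1 : left_id pi1_one pi1_mul.
Proof.
move=> a; rewrite -(pi1_reprK a) pi1_mulE.
by apply/pi1_classP; exact: homotopic_cst_cat.
Qed.

Lemma pi1_mulr1 : right_id pi1_one pi1_mul.
Proof.
move=> a; rewrite -(pi1_reprK a) pi1_mulE.
by apply/pi1_classP; exact: homotopic_cat_cst.
Qed.

Lemma pi1_mulV : left_inverse pi1_one pi1_inv pi1_mul.
Proof.
move=> a; rewrite -(pi1_reprK a) pi1_invE pi1_mulE.
by apply/pi1_classP; exact: homotopic_rev_cat.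
Qed.

Lemma pi1_mulrV : right_inverse pi1_one pi1_inv pi1_mul.
Proof.
move=> a; rewrite -(pi1_reprK a) pi1_invE pi1_mulE.
by apply/pi1_classP; exact: homotopic_cat_rev.
Qed.

HB.instance Definition _ := isGroup.Build (pi1 hx)
  pi1_mulA pi1_mul1 pi1_mulr1 pi1_mulV pi1_mulrV.

Lemma pi1_classM f g :
  (pi1_class f * pi1_class g)%g = pi1_class (path_cat f g).
Proof. exact: pi1_mulE. Qed.

Lemma pi1_classV f : ((pi1_class f)^-1)%g = pi1_class (path_rev f).
Proof. exact: pi1_invE. Qed.

End Pi1Group.

End FundamentalGroup.

Section NormalClosure.
Variable G : groupType.

Definition is_normal_subgroup (N : set G) : Prop :=
  [/\ N 1%g, forall a b, N a -> N b -> N (a * b^-1)%g &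
      forall a b, N a -> N (a ^ b)%g].

Definition normal_closure (A : set G) : set G := smallest is_normal_subgroup A.

(* A relation u = v is the pair (u, v). *)
Definition relators (r : set (G * G)) : set G :=
  [set (p.1 * p.2^-1)%g | p in r].

Definition same_relations (r s : set (G * G)) : Prop :=
  normal_closure (relators r) = normal_closure (relators s).

End NormalClosure.

(* R[i] with the topology that the library puts on a numClosedFieldType. *)
Definition cplx (R : realType) : numClosedFieldType := R[i].

Section Plane.
Variable R : realType.
Local Notation C := (cplx R).

(* e^(i t) *)
Definition expi (t : R) : C := cos t +i* sin t.

Definition unit_disc : set C := [set x | `|x| <= 1].
Definition disc : set C := [set y | `|y| <= 4].
Definition circle : set C := [set y | `|y| = 4].
Definition base_pt : C := 0 -i* 4.

(* C^k on the real plane; quantifying over all directions v amounts to taking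
   both partial derivatives. *)
Fixpoint Ck (k : nat) (f : R * R -> R) : Prop :=
  continuous f /\
  if k is k'.+1 then forall v, (forall p, derivable f p v) /\ Ck k' ('D_v f)
  else True.

Definition smooth (F : C -> C) : Prop := forall k,
  Ck k (fun p => complex.Re (F (p.1 +i* p.2))) /\
  Ck k (fun p => complex.Im (F (p.1 +i* p.2))).

(* Smoothness up to the boundary: the map extends smoothly to the plane. *)
Definition smooth_on_disc (f : C -> C) : Prop :=
  exists2 F, smooth F & forall y, disc y -> F y = f y.

Definition is_disc_diffeo (f : C -> C) : Prop :=
  smooth_on_disc f /\ exists g : C -> C,
    [/\ smooth_on_disc g,
        forall y, disc y -> disc (f y) /\ g (f y) = y &
        forall y, disc y -> disc (g y) /\ f (g y) = y].

Lemma continuous_Re : continuous (fun z : C => complex.Re z).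
Proof.
move=> z; have FF : Filter (nbhs z) by apply: _.
apply/(@cvgrPdist_lt _ _ _ (nbhs z)) => e e0.
have : nbhs z (ball z (e%:C : C)) by apply: nbhsx_ballx; rewrite ltcR.
apply: filterS => w; rewrite -ball_normE /= => zw.
have {zw} : e%:C > `|z - w| by [].
rewrite normc_def ltcR; apply: le_lt_trans.
by rewrite -sqrtr_sqr ler_wsqrtr // !raddfB lerDl sqr_ge0.
Qed.

Lemma continuous_Im : continuous (fun z : C => complex.Im z).
Proof.
move=> z; have FF : Filter (nbhs z) by apply: _.
apply/(@cvgrPdist_lt _ _ _ (nbhs z)) => e e0.
have : nbhs z (ball z (e%:C : C)) by apply: nbhsx_ballx; rewrite ltcR.
apply: filterS => w; rewrite -ball_normE /= => zw.
have {zw} : e%:C > `|z - w| by [].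
rewrite normc_def ltcR; apply: le_lt_trans.
by rewrite -sqrtr_sqr ler_wsqrtr // !raddfB lerDr sqr_ge0.
Qed.

Lemma continuous_complex (U : topologicalType) (f g : U -> R) :
  continuous f -> continuous g ->
  continuous (fun u => f u +i* g u : C).
Proof.
move=> cf cg u.
apply/cvgrPdist_lt => -[e e'] /=; rewrite ltcE /= => /andP[/eqP -> e0].
have e2 : 0 < e / 2 by lra.
have /cvgrPdist_lt/(_ _ e2) nf := cf u.
have /cvgrPdist_lt/(_ _ e2) ng := cg u.
apply: filterS2 nf ng => v hf hg.
have -> : (f u +i* g u) - (f v +i* g v) =
    (f u - f v)%:C + 'i * (g u - g v)%:C :> C.
  by apply/eqP; rewrite eq_complex /=; apply/andP; split; apply/eqP; ring.
apply: le_lt_trans (ler_normD _ _) _.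
have -> : `|'i * (g u - g v)%:C : C| = `|(g u - g v)%:C : C|.
  by rewrite normrM normc_def /= expr0n expr1n add0r sqrtr1 mul1r.
have nr (a : R) : `|a%:C : C| = `|a|%:C :> C.
  by rewrite normc_def /= expr0n addr0 sqrtr_sqr.
rewrite !nr -rmorphD /= ltcR; lra.
Qed.

Lemma smooth_continuous (F : C -> C) : smooth F -> continuous F.
Proof.
move=> /(_ 0%N)[[cR _] [cI _]].
pose coords (z : C) : R * R := (complex.Re z, complex.Im z).
have cs : continuous coords.
  by move=> z; exact: (cvg_pair (@continuous_Re z) (@continuous_Im z)).
have FE : F = fun z => complex.Re (F (complex.Re z +i* complex.Im z)) +i*
                       complex.Im (F (complex.Re z +i* complex.Im z)) :> C.
  by apply/funext => -[a b] /=; case: (F _).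
rewrite FE; apply: continuous_complex => z.
  exact: (continuous_comp (cs z) (cR _)).
exact: (continuous_comp (cs z) (cI _)).
Qed.

Lemma norm_leE (z : C) (c : R) : 0 <= c ->
  (`|z| <= c%:C) = (complex.Re z ^+ 2 + complex.Im z ^+ 2 <= c ^+ 2).
Proof.
move=> c0; rewrite normc_def lecR -[X in _ <= X](ger0_norm c0) -sqrtr_sqr.
by rewrite ler_sqrt // sqr_ge0.
Qed.

Lemma discE (z : C) : disc z <-> complex.Re z ^+ 2 + complex.Im z ^+ 2 <= 16.
Proof.
rewrite /disc /=; have -> : 4 = (4 : R)%:C :> C by rewrite rmorph_nat.
by rewrite norm_leE ?ler0n //; have -> : 4 ^+ 2 = 16 :> R by ring.
Qed.

Lemma circle_base : circle base_pt.
Proof.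
rewrite /circle /base_pt /= normc_def /= expr0n add0r sqrtr_sqr normrN.
by rewrite ger0_norm ?ler0n // rmorph_nat.
Qed.

Lemma disc_base : disc base_pt.
Proof. by rewrite /disc /= circle_base. Qed.

End Plane.

Section Braids.
Variables (R : realType) (K : set (cplx R)).
Local Notation C := (cplx R).
Local Notation D := (@disc R).
Local Notation u0 := (base_pt R).
Hypothesis hK : K `<=` D `\ u0.

Lemma punctured_base : (D `\` K) u0.
Proof. by split=> [|/hK[_ /=]]; [exact: disc_base|apply]. Qed.

Local Notation loop := (pathIn R (D `\` K) u0 u0).
Local Notation pi1K := (pi1 R punctured_base).

Record kdiffeo := KDiffeo {
  kdiffeo_fun :> C -> C;
  kdiffeo_diffeo : is_disc_diffeo kdiffeo_fun;
  kdiffeo_K : kdiffeo_fun @` K = K;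
  kdiffeo_circle : forall y, circle y -> kdiffeo_fun y = y }.

HB.instance Definition _ := gen_eqMixin kdiffeo.
HB.instance Definition _ := gen_choiceMixin kdiffeo.

Section Action.
Variable d : kdiffeo.

Lemma kdiffeo_punctured y : (D `\` K) y -> (D `\` K) (d y).
Proof.
move=> [Dy nKy]; have [_ [g [_ dg _]]] := kdiffeo_diffeo d.
have [Ddy gdy] := dg y Dy; split=> // Kdy; apply: nKy.
have : (d @` K) (d y) by rewrite kdiffeo_K.
move=> [k Kk dk]; have [_ gdk] := dg k (proj1 (hK Kk)).
by rewrite -gdy -dk gdk.
Qed.

Lemma kdiffeo_extend : exists2 F : C -> C, continuous F &
  forall y, D y -> F y = d y.
Proof.
by have [[F sF Fd] _] := kdiffeo_diffeo d; exists F => //; exact: smooth_continuous.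
Qed.

Lemma kdiffeo_base : d u0 = u0.
Proof. by apply: kdiffeo_circle; exact: circle_base. Qed.

Lemma loop_image_cont (f : loop) : {within `[0, 1], continuous (d \o f)}.
Proof.
have [F cF Fd] := kdiffeo_extend.
apply: (@within_eq _ R _ (F \o (f \o (@clamp R \o id)))).
  move=> t; apply: continuous_comp; last exact: cF.
  by apply: path_clamp_cont; exact: cont_id.
move=> t /=; rewrite in_itv /= => ht; rewrite clamp_id // Fd //.
by have [] := path_sub f ht.
Qed.

Lemma loop_image_sub (f : loop) t : 0 <= t <= 1 -> (D `\` K) (d (f t)).
Proof. by move=> ht; apply: kdiffeo_punctured; exact: path_sub. Qed.

Lemma loop_image_src (f : loop) : d (f 0) = u0.
Proof. by rewrite path_src kdiffeo_base. Qed.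

Lemma loop_image_tgt (f : loop) : d (f 1) = u0.
Proof. by rewrite path_tgt kdiffeo_base. Qed.

Definition loop_image (f : loop) : loop :=
  PathIn (@loop_image_cont f) (@loop_image_sub f)
         (loop_image_src f) (loop_image_tgt f).

Lemma homotopic_image (f g : loop) :
  homotopic f g -> homotopic (loop_image f) (loop_image g).
Proof.
move=> [H [cH XH H01 Hs]]; have [F cF Fd] := kdiffeo_extend.
pose H' (p : R * R) := H (clamp p.1, clamp p.2).
have H'E s t : 0 <= s <= 1 -> 0 <= t <= 1 -> F (H' (s, t)) = d (H (s, t)).
  move=> hs ht; rewrite /H' /= !clamp_id // Fd //.
  by have [] := XH s t hs ht.
have I0 : (fun t : R => 0 <= t <= 1) 0 by rewrite /= lexx ler01.
have I1 : (fun t : R => 0 <= t <= 1) 1 by rewrite /= lexx ler01.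
apply: (@homotopic_intro _ _ _ _ _ _ _ (F \o H')).
- move=> p; apply: continuous_comp; last exact: cF.
  exact: (square_clamp_cont cH (@cont_fst R) (@cont_snd R)).
- by move=> s t hs ht; rewrite /= H'E //; apply: kdiffeo_punctured; exact: XH.
- move=> t ht /=; rewrite !H'E //.
  by have [-> ->] := H01 t ht.
- move=> s hs /=; rewrite !H'E //.
  by have [-> ->] := Hs s hs; rewrite kdiffeo_base.
Qed.

Definition kdiffeo_pi1 (a : pi1K) : pi1K :=
  pi1_class punctured_base (loop_image (pi1_repr a)).

Lemma kdiffeo_pi1E f : kdiffeo_pi1 (pi1_class punctured_base f) =
  pi1_class punctured_base (loop_image f).
Proof. by apply/pi1_classP; apply: homotopic_image; exact: pi1_repr_class. Qed.

Lemma kdiffeo_pi1M : {morph kdiffeo_pi1 : a b / (a * b)%g}.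
Proof.
move=> a b; rewrite -(pi1_reprK a) -(pi1_reprK b).
move: (pi1_repr a) (pi1_repr b) => f g.
rewrite pi1_classM (kdiffeo_pi1E f) (kdiffeo_pi1E g) pi1_classM kdiffeo_pi1E.
apply/pi1_classP; apply: homotopic_ext => t _ /=.
by rewrite /cat_fun; case: ifP.
Qed.

End Action.

Definition same_action (d e : kdiffeo) := `[< kdiffeo_pi1 d = kdiffeo_pi1 e >].

Lemma same_action_refl : reflexive same_action.
Proof. by move=> d; apply/asboolP. Qed.

Lemma same_action_sym : symmetric same_action.
Proof. by move=> d e; apply/asboolP/asboolP. Qed.

Lemma same_action_trans : transitive same_action.
Proof. by move=> e d f /asboolP de /asboolP ef; apply/asboolP; rewrite de. Qed.

Canonical same_action_equiv :=
  EquivRel same_action same_action_refl same_action_sym same_action_trans.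

(* The underlying set of the braid group B_n[D, K]. *)
Definition braid := {eq_quot same_action_equiv}.

Definition braid_class (d : kdiffeo) : braid := \pi_braid d.

Definition braid_act (b : braid) : pi1K -> pi1K := kdiffeo_pi1 (repr b).

Lemma braid_classP d e :
  braid_class d = braid_class e <-> kdiffeo_pi1 d = kdiffeo_pi1 e.
Proof. by split=> [/eqmodP /= /asboolP //|de]; apply/eqmodP => /=; apply/asboolP. Qed.

Lemma braid_act_class d : braid_act (braid_class d) = kdiffeo_pi1 d.
Proof. by apply/braid_classP; exact: reprK. Qed.

Definition is_motion n (m : 'I_n -> R -> C) : Prop :=
  [/\ forall i, {within `[0, 1], continuous (m i)},
      forall i t, 0 <= t <= 1 -> D (m i t),
      forall i j t, 0 <= t <= 1 -> i != j -> m i t != m j t,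
      [set m i 0 | i in [set: 'I_n]] = K &
      [set m i 1 | i in [set: 'I_n]] = K].

(* The continuity of the family of diffeomorphisms is joint continuity in the
   time and the point. *)
Definition realizes n (Dt : R -> C -> C) (m : 'I_n -> R -> C) : Prop :=
  [/\ {within `[0, 1] `*` D, continuous (fun p : R * C => Dt p.1 p.2)},
      forall t, 0 <= t <= 1 ->
        is_disc_diffeo (Dt t) /\ (forall y, circle y -> Dt t y = y),
      forall y, D y -> Dt 0 y = y &
      forall i t, 0 <= t <= 1 -> Dt t (m i 0) = m i t].

Definition induced_braid n (m : 'I_n -> R -> C) (b : braid) : Prop :=
  is_motion m /\ exists2 Dt, realizes Dt m &
  exists2 d : kdiffeo, (forall y, D y -> d y = Dt 1 y) & b = braid_class d.

Definition induced_relations n (x : 'I_n -> pi1K) (b : braid) :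
    set (pi1K * pi1K) :=
  [set (braid_act b (x j), x j) | j in [set: 'I_n]].

End Braids.

Section Monodromy.
Variable R : realType.
Local Notation C := (cplx R).
Local Notation D := (@disc R).

Definition fiber (S : set (C * C)) (x : C) : set C := [set y | S (x, y)].

Definition is_local_monodromy (S : set (C * C))
    (hS : fiber S 1 `<=` D `\ base_pt R) (b : braid hS) : Prop :=
  exists n (m : 'I_n -> R -> C),
    (forall t, 0 <= t <= 1 ->
       [set m i t | i in [set: 'I_n]] = fiber S (expi (2 * pi * t))) /\
    induced_braid m b.

End Monodromy.

Section Curve.
Variable R : realType.
Local Notation C := (cplx R).
Local Notation D := (@disc R).
Local Notation u0 := (base_pt R).

Definition curve : set (C * C) := [set p | unit_disc p.1 /\ disc p.2 /\
  let: (x, y) := p in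
  y * (2 * x + y) * (y + x ^+ 2) * (y - x ^+ 2) = 0].

(* The points -2 < -1 < 0 < 1 of the fiber over x = 1. *)
Definition fiber_pt (i : 'I_4) : C := (i%:R - 2)%:C.

Lemma fiber1E : fiber curve 1 = [set fiber_pt i | i in [set: 'I_4]].
Proof.
have pE : forall i : 'I_4, disc (fiber_pt i) /\
    (fiber_pt i = - 2 \/ fiber_pt i = - 1 \/ fiber_pt i = 0 \/ fiber_pt i = 1).
  move=> i; split.
    apply/discE; rewrite /= expr0n addr0.
    by case: i => -[|[|[|[|//]]]] /= _; lra.
  rewrite /fiber_pt; case: i => -[|[|[|[|//]]]] /= _; rewrite rmorphB /= ?rmorph_nat.
  - by left; ring.
  - by right; left; ring.
  - by right; right; left; ring.
  - by right; right; right; ring.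
apply/seteqP; split=> y.
  move=> [_ [_ /= /eqP]]; rewrite expr1n mulr1 !mulf_eq0 -!orbA => /or4P[] /eqP h.
  - by exists (inord 2) => //; rewrite /fiber_pt inordK // subrr.
  - exists (inord 0) => //; rewrite /fiber_pt inordK // rmorphB /= rmorph_nat.
    by apply/eqP; rewrite eq_sym -subr_eq0 -[X in _ == X]h; apply/eqP; ring.
  - exists (inord 1) => //; rewrite /fiber_pt inordK // rmorphB /= rmorph_nat.
    by apply/eqP; rewrite eq_sym -subr_eq0 -[X in _ == X]h; apply/eqP; ring.
  - exists (inord 3) => //; rewrite /fiber_pt inordK // rmorphB /= !rmorph_nat.
    by apply/eqP; rewrite eq_sym -subr_eq0 -[X in _ == X]h; apply/eqP; ring.
move=> [i _ <-]; have [Dp hp] := pE i; split; first by rewrite /unit_disc /= normr1.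
split=> //=; case: hp => [->|[->|[->|->]]]; ring.
Qed.

Lemma fiber1_sub : fiber curve 1 `<=` D `\ u0.
Proof.
move=> y Ky; split; first by case: Ky => _ [].
move: Ky; rewrite fiber1E => -[i _ <-] /= /(congr1 (@complex.Im R)) /= /eqP.
by rewrite eq_sym oppr_eq0 pnatr_eq0.
Qed.

Local Notation K := (fiber curve 1).
Local Notation pathDK := (pathIn R (D `\` K)).

(* The loop around p = fiber_pt i is a segment, a circle and the segment reversed.
   The circle is p + r (u0 - p) e^(2 pi i t) with r = 1/10, of radius
   r |u0 - p| < 1/2, so it starts on the segment from u0 to p. *)
Definition gbase_radius (i : 'I_4) : C := (10^-1)%:C * (u0 - fiber_pt i).

Definition gbase_foot (i : 'I_4) : C := fiber_pt i + gbase_radius i.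

Definition gbase_segment_fun (i : 'I_4) (t : R) : C :=
  (1 - t)%:C * u0 + t%:C * gbase_foot i.

Definition gbase_circle_fun (i : 'I_4) (t : R) : C :=
  fiber_pt i + gbase_radius i * expi (2 * pi * t).

Lemma gbase_segment_coord (i : 'I_4) (t : R) : gbase_segment_fun i t =
  (9 / 10 * (i%:R - 2) * t) +i* (- (4 - 18 / 5 * t)).
Proof.
rewrite /gbase_segment_fun /gbase_foot /gbase_radius /fiber_pt /base_pt.
by apply/eqP; rewrite eq_complex /=; apply/andP; split; apply/eqP; field.
Qed.

Lemma gbase_circle_coord (i : 'I_4) (t : R) : let a := i%:R - 2 : R in
  let c := cos (2 * pi * t) in let s := sin (2 * pi * t) in
  gbase_circle_fun i t =
  (a + (2 / 5 * s - a / 10 * c)) +i* (- (2 / 5 * c + a / 10 * s)).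
Proof.
move=> a c s; rewrite /gbase_circle_fun /gbase_radius /fiber_pt /base_pt /expi.
by apply/eqP; rewrite eq_complex /=; apply/andP; split; apply/eqP;
  rewrite -/a -/c -/s; field.
Qed.

Lemma fiber_pt_bound (i : 'I_4) : (i%:R - 2 : R) ^+ 2 <= 4.
Proof. by case: i => -[|[|[|[|//]]]] /= _; lra. Qed.

Lemma fiber_pt_gap (i j : 'I_4) :
  ((j%:R - 2) - (i%:R - 2) : R) ^+ 2 <= 0 \/
  1 <= ((j%:R - 2) - (i%:R - 2) : R) ^+ 2.
Proof.
case: i => -[|[|[|[|//]]]] /= _; case: j => -[|[|[|[|//]]]] /= _;
  by [left; lra|right; lra].
Qed.

Lemma gbase_segment_sub i t : 0 <= t <= 1 -> (D `\` K) (gbase_segment_fun i t).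
Proof.
move=> /andP[t0 t1]; rewrite gbase_segment_coord; split.
  apply/discE => /=; have := fiber_pt_bound i; set a := _ - 2 => ha.
  have := sqr_ge0 t; nra.
rewrite fiber1E => -[j _ /(congr1 (@complex.Im R)) /=]; lra.
Qed.

Lemma gbase_circle_sub i t : 0 <= t <= 1 -> (D `\` K) (gbase_circle_fun i t).
Proof.
move=> _; rewrite gbase_circle_coord /=.
have := cos2Dsin2 (2 * pi * t : R); have := fiber_pt_bound i.
set a := _ - 2; set c := cos _; set s := sin _ => ha cs.
have rE : (2 / 5 * s - a / 10 * c) ^+ 2 + (2 / 5 * c + a / 10 * s) ^+ 2 =
    4 / 25 + a ^+ 2 / 100.
  have -> : 4 / 25 + a ^+ 2 / 100 = (4 / 25 + a ^+ 2 / 100) * (c ^+ 2 + s ^+ 2).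
    by rewrite cs mulr1.
  by field.
split.
  apply/discE => /=; set p := 2 / 5 * s - _; rewrite -/p in rE.
  have := sqr_ge0 (a - p); nra.
rewrite fiber1E => -[j _ E].
have := congr1 (@complex.Re R) E; have := congr1 (@complex.Im R) E => /= E1 E2.
have {}E1 : 2 / 5 * c + a / 10 * s = 0 by lra.
have {}E2 : 2 / 5 * s - a / 10 * c = (j%:R - 2) - a by lra.
rewrite E1 E2 expr0n addr0 in rE; have := sqr_ge0 a.
by have [] := fiber_pt_gap i j; rewrite -/a; lra.
Qed.

Lemma gbase_segment_cont i : {within `[0, 1], continuous (gbase_segment_fun i)}.
Proof.
apply: (@within_eq _ R _ (fun t => (9 / 10 * (i%:R - 2) * t + 0) +i*
   (18 / 5 * t + (- 4)) : C)).
  by apply: continuous_complex; exact: affine_cont (@cont_id R).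
move=> t _; rewrite gbase_segment_coord.
by apply/eqP; rewrite eq_complex /=; apply/andP; split; apply/eqP; ring.
Qed.

Lemma continuous_expi : continuous (fun t : R => expi t).
Proof. by apply: continuous_complex; [exact: continuous_cos|exact: continuous_sin]. Qed.

Lemma gbase_circle_cont i : {within `[0, 1], continuous (gbase_circle_fun i)}.
Proof.
apply: continuous_subspaceT => t.
apply: cvgD; first exact: cvg_cst.
apply: cvgM; first exact: cvg_cst.
apply: (@continuous_comp _ _ _ (fun t : R => 2 * pi * t) (fun t => expi t)).
  by apply: cvgM; [exact: cvg_cst|exact: cvg_id].
exact: continuous_expi.
Qed.

Lemma gbase_segment0 i : gbase_segment_fun i 0 = u0.
Proof. by rewrite /gbase_segment_fun subr0 mul1r mul0r addr0. Qed.

Lemma gbase_segment1 i : gbase_segment_fun i 1 = gbase_foot i.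
Proof. by rewrite /gbase_segment_fun subrr mul1r mul0r add0r. Qed.

Lemma expi0 : expi 0 = 1 :> C.
Proof. by rewrite /expi cos0 sin0. Qed.

Lemma expi2pi : expi (2 * pi) = 1 :> C.
Proof. by rewrite /expi mulr_natl cos2pi sin2pi. Qed.

Lemma gbase_circle0 i : gbase_circle_fun i 0 = gbase_foot i.
Proof. by rewrite /gbase_circle_fun mulr0 expi0 mulr1. Qed.

Lemma gbase_circle1 i : gbase_circle_fun i 1 = gbase_foot i.
Proof. by rewrite /gbase_circle_fun mulr1 expi2pi mulr1. Qed.

Definition gbase_segment i : pathDK u0 (gbase_foot i) :=
  PathIn (@gbase_segment_cont i) (@gbase_segment_sub i)
         (gbase_segment0 i) (gbase_segment1 i).

Definition gbase_circle i : pathDK (gbase_foot i) (gbase_foot i) :=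
  PathIn (@gbase_circle_cont i) (@gbase_circle_sub i)
         (gbase_circle0 i) (gbase_circle1 i).

Definition gbase_loop i : pathDK u0 u0 :=
  path_cat (path_cat (gbase_segment i) (gbase_circle i))
           (path_rev (gbase_segment i)).

Definition gbase (i : 'I_4) : pi1 R (punctured_base fiber1_sub) :=
  pi1_class (punctured_base fiber1_sub) (gbase_loop i).

(* On [0, 1/2] the points -1, 0, 1 turn about 0 by 4 pi; on [1/2, 1] the point
   -2 makes one revolution along the circle of radius 2. *)
Definition twist_motion (i : 'I_4) (t : R) : C :=
  if t <= 2^-1 then
    if i == ord0 then fiber_pt i else fiber_pt i * expi (4 * pi * (2 * t))
  else
    if i == ord0 then fiber_pt i * expi (2 * pi * (2 * t - 1)) else fiber_pt i.

End Curve.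

(* Main.v *)
Require Import Defs.
From HB Require Import structures.
From mathcomp Require Import all_boot all_order all_algebra.
From mathcomp Require Import complex ring lra.
From mathcomp Require Import mathcomp_extra boolp classical_sets functions.
From mathcomp Require Import reals topology normedtype derive trigo.

(** Both motions are induced by spins y |-> y exp(i theta(|y|^2)): let theta(t, q)
    be polynomial in q with theta(t, 16) = 0 and let theta(t, 1), theta(t, 4) be
    the angles through which the circles |y| = 1 and |y| = 2 have turned at time t.
    At t = 1 the two motions give the same diffeomorphism, with angles 4 pi and
    2 pi.  Any other family realizing a motion acts in the same way on loops: if
    L_t are loops avoiding the points at time t, then D_1 D_t^-1 L_t is a homotopy
    from D_1 L_0 to L_1.

    For the action on the g-base, deform the angle function instead of the loops.
    Deforming the twist to the composite of a twist supported in |y| < 3/2 with a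
    full rigid rotation moves only the base point, around |y| = 4; undoing the inner
    twist moves the base point around the three inner points.  Hence, writing
    A = x4 x3 x2 and T = A x1, the loop x1 goes to T x1 T^-1 and the loops x2, x3,
    x4 are conjugated by T A, which gives the relations.  Words in the g-base are
    compared with actual loops by recording through which gaps of K on the real
    axis a loop crosses between the lower and the upper half plane. *)

Set Implicit Arguments.
Unset Strict Implicit.
Unset Printing Implicit Defensive.

Import Order.TTheory GRing.Theory Num.Theory.
Import numFieldNormedType.Exports.

Local Open Scope classical_set_scope.
Local Open Scope complex_scope.
Local Open Scope ring_scope.

(** * Relations modulo a normal subgroup *)

Section GroupRelations.
Variable G : groupType.
Local Open Scope group_scope.

Lemma normal_closure_normal (A : set G) : is_normal_subgroup (normal_closure A).
Proof.
split=> [M [[]]//|a b Na Nb M hM|a b Na M hM]; case: (hM) => -[M1 MV MJ] AM.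
  by apply: MV; [exact: Na|exact: Nb].
by apply: MJ; exact: Na.
Qed.

Lemma sub_normal_closure (A N : set G) :
  is_normal_subgroup N -> A `<=` N -> normal_closure A `<=` N.
Proof. by move=> nN AN a; apply; split. Qed.

Section Congruence.
Variable N : set G.
Hypothesis nN : is_normal_subgroup N.

Lemma normal_mem1 : N 1. Proof. by case: nN. Qed.

Lemma normal_memV a : N a -> N a^-1.
Proof. by case: nN => N1 NV _ /(NV _ _ N1); rewrite mul1g. Qed.

Lemma normal_memM a b : N a -> N b -> N (a * b).
Proof. by case: (nN) => _ NV _ Na /normal_memV/(NV _ _ Na); rewrite invgK. Qed.

Lemma normal_memJ a b : N a -> N (b * a * b^-1).
Proof. by case: nN => _ _ NJ /(NJ _ b^-1); rewrite conjgE invgK mulgA. Qed.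

(** Equality in the quotient by [N], without forming the quotient group. *)
Definition eqmod a b := N (a * b^-1).

Lemma eqmod_refl a : eqmod a a.
Proof. by rewrite /eqmod mulgV; exact: normal_mem1. Qed.

Lemma eqmod_sym a b : eqmod a b -> eqmod b a.
Proof. by move=> /normal_memV; rewrite /eqmod invgM invgK. Qed.

Lemma eqmod_trans b a c : eqmod a b -> eqmod b c -> eqmod a c.
Proof. by move=> ab bc; have := normal_memM ab bc; rewrite mulgA mulgVK. Qed.

Lemma eqmodMl c a b : eqmod a b -> eqmod (c * a) (c * b).
Proof. by move=> /(@normal_memJ _ c); rewrite /eqmod invgM !mulgA. Qed.

Lemma eqmodMr c a b : eqmod a b -> eqmod (a * c) (b * c).
Proof. by rewrite /eqmod invgM -!mulgA mulVKg. Qed.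

Definition commute_mod a b := eqmod (a * b) (b * a).

Lemma commute_mod_sym a b : commute_mod a b -> commute_mod b a.
Proof. exact: eqmod_sym. Qed.

Lemma commute_modM a b c :
  commute_mod a b -> commute_mod a c -> commute_mod a (b * c).
Proof.
move=> /(eqmodMr c) ab /(eqmodMl b) ac.
by apply: (@eqmod_trans (b * a * c)); rewrite ?mulgA // -?mulgA // mulgA.
Qed.

Lemma commute_modV a b : commute_mod a b -> commute_mod a b^-1.
Proof.
move=> /(eqmodMl b^-1)/(eqmodMr b^-1); rewrite mulKg !mulgA mulgK.
exact: eqmod_sym.
Qed.

Lemma eqmod_commute a b c :
  eqmod a b -> commute_mod a c -> commute_mod b c.
Proof.
move=> ab ac; apply: (@eqmod_trans (a * c)); first exact/eqmodMr/eqmod_sym.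
by apply: eqmod_trans ac _; exact: eqmodMl.
Qed.

Lemma eqmodJ a b : eqmod (a * b * a^-1) b <-> commute_mod a b.
Proof.
split=> [/(eqmodMr a)|/(eqmodMr a^-1)]; first by rewrite mulgVK.
by rewrite mulgK.
Qed.

End Congruence.

(** Put w = A^2 x1. The first condition on either side says that x1 and A commute modulo [N], and
    then W and w agree. Since [x4 * u] is the word w x4, the second relation says that w commutes
    with x4; since x3 times the last word is [u * x3], the third says that it commutes with x3.
    Commutation with x2 = (x4 x3)^-1 A follows, as w commutes with A. *)
Lemma twist_relations_eqmod (N : set G) (x1 x2 x3 x4 : G) :
  is_normal_subgroup N ->
  let A := x4 * x3 * x2 in let W := A * x1 * A in
  [/\ commute_mod N (A * x1) x1, commute_mod N W x2,
      commute_mod N W x3 & commute_mod N W x4] <->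
  [/\ eqmod N (x1 * x4 * x3 * x2) (x4 * x3 * x2 * x1),
      eqmod N (A ^+ 2 * x1) (x3 * x2 * x4 * x3 * x2 * x1 * x4) &
      eqmod N (x3 * x2 * x4 * x3 * x2 * x1 * x4)
              (x2 * x4 * x3 * x2 * x1 * x4 * x3)].
Proof.
move=> nN A W; set u := x3 * x2 * x4 * x3 * x2 * x1 * x4.
have cM := commute_modM nN; have cS := commute_mod_sym nN.
have e1 : x1 * x4 * x3 * x2 = x1 * A by rewrite /A !mulgA.
have e2 : x4 * u = A ^+ 2 * x1 * x4 by rewrite /u expgS expg1 /A !mulgA.
have e3 : x3 * (x2 * x4 * x3 * x2 * x1 * x4 * x3) = u * x3 by rewrite /u !mulgA.
have Ww : commute_mod N x1 A -> eqmod N W (A ^+ 2 * x1).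
  by move=> /(eqmodMl nN A); rewrite /W expgS expg1 !mulgA.
have cl b a c : eqmod N (b * a) (b * c) -> eqmod N a c.
  by move=> /(eqmodMl nN b^-1); rewrite !mulKg.
split=> [[c1 c2 c3 c4]|[r1 r2 r3]].
  have {}c1 : commute_mod N x1 A.
    by move: c1 => /cS/(eqmodMr x1^-1); rewrite /commute_mod !mulgA !mulgK.
  have Ww1 := Ww c1.
  have c3' := eqmod_commute nN Ww1 c3; have c4' := eqmod_commute nN Ww1 c4.
  have wu : eqmod N (A ^+ 2 * x1) u by apply: (cl x4); rewrite e2; exact/cS.
  split=> //; first by rewrite e1.
  by apply: (cl x3); rewrite e3; apply/cS; exact: eqmod_commute wu c3'.
have c1 : commute_mod N x1 A by move: r1; rewrite e1.
have wW := eqmod_sym nN (Ww c1).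
have c4 : commute_mod N (A ^+ 2 * x1) x4.
  by apply/cS; rewrite /commute_mod -e2; exact: eqmodMl.
have c3 : commute_mod N (A ^+ 2 * x1) x3.
  apply: (eqmod_commute nN (eqmod_sym nN r2)); apply/cS.
  by rewrite /commute_mod -e3; exact: eqmodMl.
have cA : commute_mod N (A ^+ 2 * x1) A.
  have AA : commute_mod N A A by exact: eqmod_refl.
  by apply/cS; rewrite expgS expg1; do 2?apply/cM => //; exact/cS.
have c2 : commute_mod N (A ^+ 2 * x1) x2.
  have -> : x2 = (x4 * x3)^-1 * A by rewrite /A mulKg.
  by apply/cM => //; apply: commute_modV => //; exact: cM.
split; try exact: eqmod_commute wW _.
apply/cS; apply/cM; first exact: c1.
exact: eqmod_refl.
Qed.

(** A relation g x g^-1 = x says that g and x commute; here g is T for x1, and T A, the word W of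
    [twist_relations_eqmod], for the other generators. *)
Lemma twist_same_relations (x : 'I_4 -> G) (rel : set (G * G)) :
  let x1 := x (inord 0) in let x2 := x (inord 1) in
  let x3 := x (inord 2) in let x4 := x (inord 3) in
  let A := x4 * x3 * x2 in let T := A * x1 in
  (forall p, rel p <-> p = (T * x1 * T^-1, x1) \/
     exists2 j : 'I_4, j != ord0 & p = (T * (A * x j * A^-1) * T^-1, x j)) ->
  same_relations rel
    [set (x1 * x4 * x3 * x2, x4 * x3 * x2 * x1);
         ((x4 * x3 * x2) ^+ 2 * x1, x3 * x2 * x4 * x3 * x2 * x1 * x4);
         (x3 * x2 * x4 * x3 * x2 * x1 * x4, x2 * x4 * x3 * x2 * x1 * x4 * x3)].
Proof.
move=> x1 x2 x3 x4 A T relE.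
have TJ j : T * (A * x j * A^-1) * T^-1 = T * A * x j * (T * A)^-1.
  by move: (T) (A) => T1 A1; rewrite invgM !mulgA.
apply/seteqP; split; apply: sub_normal_closure => [|_ [p pr <-]];
  try exact: normal_closure_normal.
  set N := normal_closure _; have nN : is_normal_subgroup N.
    exact: normal_closure_normal.
  have [|c1 c2 c3 c4] := proj2 (twist_relations_eqmod x1 x2 x3 x4 nN).
    by split=> M [_]; apply; eexists;
      [by left; left|by []|by left; right|by []|by right|by []].
  have /relE[->|[j j0 ->]] := pr; first exact: (proj2 (@eqmodJ N _ _)).
  rewrite TJ; apply: (proj2 (@eqmodJ N _ _)).
  case: j j0 => -[|[|[|[|//]]]] jlt // _.
  - by have -> : Ordinal jlt = inord 1 by apply/val_inj; rewrite /= inordK.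
  - by have -> : Ordinal jlt = inord 2 by apply/val_inj; rewrite /= inordK.
  - by have -> : Ordinal jlt = inord 3 by apply/val_inj; rewrite /= inordK.
set N := normal_closure _; have nN : is_normal_subgroup N.
  exact: normal_closure_normal.
have relN a b : rel (a, b) -> eqmod N a b.
  by move=> rab M [_]; apply; exists (a, b).
have [|r1 r2 r3] := proj1 (twist_relations_eqmod x1 x2 x3 x4 nN); last first.
  by case: pr => [[->|->]|->].
split; apply: (proj1 (@eqmodJ N _ _)); rewrite -?TJ; apply: relN; apply/relE;
  first by left.
- by right; exists (inord 1) => //; rewrite -val_eqE /= inordK.
- by right; exists (inord 2) => //; rewrite -val_eqE /= inordK.
- by right; exists (inord 3) => //; rewrite -val_eqE /= inordK.
Qed.

End GroupRelations.

(** * Free homotopies *)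

Section Clamp.
Variable R : realType.
Implicit Types x : R.

Lemma clamp_ge1 x : 1 <= x -> clamp x = 1.
Proof. by move=> x1; rewrite /clamp min_l // max_r. Qed.

Lemma clamp_le0 x : x <= 0 -> clamp x = 0.
Proof. by move=> x0; rewrite /clamp max_l // ge_min x0 orbT. Qed.

Lemma continuous_clamp_affine (U : topologicalType) (k : U -> R) (a b : R) :
  continuous k -> continuous (fun u => clamp (a * k u + b)).
Proof.
move=> ck; apply: (@continuous_clamped _ _ (fun u => a * k u + b)).
exact: affine_cont.
Qed.

Lemma continuous_mix (u v : R * R -> R) : continuous u -> continuous v ->
  continuous (fun p : R * R => (1 - p.1) * u p + p.1 * v p).
Proof.
move=> cu cv p; apply: cvgD; apply: cvgM; [|exact: cu| |exact: cv].
  by apply: cvgB; [exact: cvg_cst|exact: cvg_fst].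
exact: cvg_fst.
Qed.

End Clamp.

Section PathTools.
Variables (R : realType) (T : topologicalType) (X : set T).

(* The two routes around the boundary of the square from (0, 0) to (1, 1) are
   joined by the straight-line homotopy inside the square. *)
Lemma homotopic_square x (f g al : pathIn R X x x) (H : R * R -> T) :
  {within `[0, 1] `*` `[0, 1], continuous H} ->
  (forall s t, 0 <= s <= 1 -> 0 <= t <= 1 -> X (H (s, t))) ->
  (forall t, 0 <= t <= 1 -> H (0, t) = f t /\ H (1, t) = g t) ->
  (forall s, 0 <= s <= 1 -> H (s, 0) = al s /\ H (s, 1) = al s) ->
  homotopic (path_cat f al) (path_cat al g).
Proof.
move=> cH XH H01 Hs.
pose a (t : R) := clamp (2 * t - 1); pose b (t : R) := clamp (2 * t).
have ca : continuous (fun p : R * R => a p.2).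
  by apply: continuous_clamp_affine; exact: cont_snd.
have cb : continuous (fun p : R * R => b p.2).
  have -> : (fun p : R * R => b p.2) = (fun p => clamp (2 * p.2 + 0)).
    by apply/funext => p; rewrite addr0.
  by apply: continuous_clamp_affine; exact: cont_snd.
have I0 : 0 <= (0 : R) <= 1 by rewrite lexx ler01.
have I1 : 0 <= (1 : R) <= 1 by rewrite lexx ler01.
apply: (@homotopic_intro _ _ _ _ _ _ _ (fun p : R * R =>
   H (clamp ((1 - p.1) * a p.2 + p.1 * b p.2),
      clamp ((1 - p.1) * b p.2 + p.1 * a p.2)))).
- by apply: square_clamp_cont => //; exact: continuous_mix.
- by move=> s t _ _; apply: XH; exact: clamp_itv.
- move=> t ht /=; rewrite !subr0 !subrr !mul1r !mul0r !addr0 !add0r.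
  rewrite !(@clamp_id _ (a t)) ?(@clamp_id _ (b t)) ?clamp_itv // /cat_fun /a /b.
  case: (leP t 2^-1) => h.
    rewrite (@clamp_le0 _ (2 * t - 1)); last lra.
    rewrite clamp_id; last lra.
    by split; [case: (H01 (2 * t)) => //; lra|case: (Hs (2 * t)) => //; lra].
  rewrite (@clamp_ge1 _ (2 * t)); last lra.
  rewrite clamp_id; last lra.
  by split; [case: (Hs (2 * t - 1)) => //; lra|case: (H01 (2 * t - 1)) => //; lra].
- move=> s hs /=; rewrite /a /b mulr0 mulr1 sub0r.
  rewrite (@clamp_le0 _ (-1)); last lra.
  have -> : 2 - 1 = 1 :> R by lra.
  rewrite (@clamp_ge1 _ 2); last lra.
  rewrite !(@clamp_id _ 0) ?(@clamp_id _ 1) // !mulr0 !mulr1 !addr0 subrK.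
  rewrite !clamp_id //.
  have [-> _] := H01 0 I0; have [_ ->] := H01 1 I1.
  by rewrite path_src path_tgt.
Qed.

Lemma path_class_conj x (hx : X x) (f g al : pathIn R X x x) :
  homotopic (path_cat f al) (path_cat al g) ->
  pi1_class hx f =
    (pi1_class hx al * pi1_class hx g * (pi1_class hx al)^-1)%g.
Proof.
by move=> /(pi1_classP hx); rewrite -!pi1_classM => <-; rewrite mulgK.
Qed.

(** The base point travels along the closed path [al], and [homotopic_square] turns this track into
    a conjugating element. *)
Lemma free_homotopy_class x (hx : X x) (f g : pathIn R X x x) (H : R * R -> T) :
  {within `[0, 1] `*` `[0, 1], continuous H} ->
  (forall s t, 0 <= s <= 1 -> 0 <= t <= 1 -> X (H (s, t))) ->
  (forall t, 0 <= t <= 1 -> H (0, t) = f t /\ H (1, t) = g t) ->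
  (forall s, 0 <= s <= 1 -> H (s, 0) = H (s, 1)) ->
  exists2 al : pathIn R X x x, (forall s, 0 <= s <= 1 -> al s = H (s, 0)) &
    pi1_class hx f = (pi1_class hx al * pi1_class hx g * (pi1_class hx al)^-1)%g.
Proof.
move=> cH XH H01 Hs.
have I0 : 0 <= (0 : R) <= 1 by rewrite lexx ler01.
have I1 : 0 <= (1 : R) <= 1 by rewrite lexx ler01.
have cal : {within `[0, 1], continuous (fun s => H (s, 0))}.
  apply: (@within_eq _ R _ (fun s => H (clamp s, clamp 0))).
    apply: square_clamp_cont cH (@cont_id R) _.
    by move=> s; exact: cvg_cst.
  by move=> s; rewrite /= in_itv => hs; rewrite !clamp_id.
have alX s : 0 <= s <= 1 -> X (H (s, 0)) by move=> hs; exact: XH.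
have al0 : H (0, 0) = x by case: (H01 0 I0) => -> _; rewrite path_src.
have al1 : H (1, 0) = x by case: (H01 0 I0) => _ ->; rewrite path_src.
pose al := PathIn cal alX al0 al1; exists al => //.
apply: path_class_conj; apply: (@homotopic_square _ _ _ _ H) => // s hs.
by rewrite -Hs.
Qed.

(** Makes products of loops that go out along one path and return along another telescope. *)
Lemma cat_rev_cancel x y z (hy : X y) (f : pathIn R X x y) (g : pathIn R X z y)
    (h : pathIn R X x y) : homotopic (path_cat (path_cat f (path_rev g))
                                               (path_cat g (path_rev h)))
                                     (path_cat f (path_rev h)).
Proof.
apply: homotopic_trans (homotopic_sym (homotopic_catA _ _ _)) _.
apply: homotopic_cat; first exact: homotopic_refl.
apply: homotopic_trans (homotopic_catA _ _ _) _.
apply: homotopic_trans (homotopic_cst_cat hy _).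
apply: homotopic_cat; last exact: homotopic_refl.
exact: homotopic_rev_cat.
Qed.

End PathTools.

(** * Transport of loops along a motion *)

Section Compactness.

Lemma hausdorff_prod (U V : topologicalType) :
  hausdorff_space U -> hausdorff_space V -> hausdorff_space (U * V)%type.
Proof.
move=> hU hV [a b] [c d] cl; congr (_, _).
  apply: hU => A B nA nB.
  have [] := cl (fst @^-1` A) (fst @^-1` B); try exact: cvg_fst.
  by move=> [x y] [] /= ? ?; exists x.
apply: hV => A B nA nB.
have [] := cl (snd @^-1` A) (snd @^-1` B); try exact: cvg_snd.
by move=> [x y] [] /= ? ?; exists y.
Qed.

(** Within P(Q), the preimage under [g] of a closed set W is the image under [P] of the part of W in
    Q; this is the continuous image of a compact set, hence closed. *)
Lemma compact_inverse_continuous (U V : topologicalType) (Q : set U)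
    (P : U -> V) (g : V -> U) : hausdorff_space V -> compact Q ->
  {within Q, continuous P} -> (forall u, Q u -> g (P u) = u) ->
  {within P @` Q, continuous g}.
Proof.
move=> hV cQ cP gP; apply/continuous_closedP => W cW; apply/closed_subspaceP.
exists (P @` (Q `&` W)).
  apply: compact_closed => //; apply: continuous_compact.
    by apply: continuous_subspaceW cP; exact: subIsetl.
  exact: compact_closedI.
apply/seteqP; split=> v [].
  move=> [u [Qu Wu] <-] _; split; last by exists u.
  by have : W (g (P u)) by rewrite gP.
move=> Wg [u Qu uv]; have Wu : W u by rewrite -(gP u Qu) uv.
by split; exists u.
Qed.

Variable R : realType.

Lemma compact_disc : compact (@disc R).
Proof.
pose c (p : R * R) : cplx R := p.1 +i* p.2.
have cc : continuous c by exact: continuous_complex (@cont_fst R) (@cont_snd R).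
have -> : @disc R = (c @` (`[-4, 4] `*` `[-4, 4])) `&` @disc R.
  apply/seteqP; split=> [z Dz|z []//]; split=> //.
  exists (complex.Re z, complex.Im z); last by rewrite /c; case: z {Dz}.
  move/discE: Dz; case: z => x y /= xy.
  by rewrite !in_itv /=; split; nra.
apply: compact_closedI.
  apply: continuous_compact; first exact: continuous_subspaceT.
  by apply: compact_setX; exact: segment_compact.
have -> : @disc R = (fun z : cplx R => complex.Re z * complex.Re z
    + complex.Im z * complex.Im z) @^-1` [set x | x <= 16].
  by apply/seteqP; split=> z /discE.
apply: preimage_closed; last exact: closed_le.
move=> z _; have FF : Filter (nbhs z) by apply: _.
apply: cvgD.
  by apply: cvgM; exact: continuous_Re.
by apply: cvgM; exact: continuous_Im.
Qed.

End Compactness.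

Section Transport.
Variables (R : realType) (K : set (cplx R)).
Local Notation C := (cplx R).
Local Notation D := (@disc R).
Local Notation u0 := (base_pt R).
Hypothesis hK : K `<=` D `\ u0.
Local Notation loop := (pathIn R (D `\` K) u0 u0).

(* With H(t, s) = D_1 (D_t^-1 (L(t, s))), the homotopy stays off K because L
   stays off the moving points. *)
Lemma loop_image_transport n (m : 'I_n -> R -> C) (Dt : R -> C -> C)
    (d : kdiffeo K) (f g : loop) (L : R * R -> C) :
  is_motion K m -> realizes Dt m -> (forall y, D y -> d y = Dt 1 y) ->
  {within `[0, 1] `*` `[0, 1], continuous L} ->
  (forall t s, 0 <= t <= 1 -> 0 <= s <= 1 ->
     D (L (t, s)) /\ forall i, m i t <> L (t, s)) ->
  (forall s, 0 <= s <= 1 -> L (0, s) = f s /\ L (1, s) = g s) ->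
  (forall t, 0 <= t <= 1 -> L (t, 0) = u0 /\ L (t, 1) = u0) ->
  homotopic (loop_image hK d f) g.
Proof.
move=> [_ mD _ _ m1] [cDt diffD D0 Dm] dE cL LX L01 Lb.
have I0 : 0 <= (0 : R) <= 1 by rewrite lexx ler01.
have I1 : 0 <= (1 : R) <= 1 by rewrite lexx ler01.
(* For times in [0, 1] and [y] in the disc the default value of [xget] never occurs, by [invP]. *)
pose inv (t : R) (y : C) : C := xget y [set z | D z /\ Dt t z = y].
have injD t y z : 0 <= t <= 1 -> D y -> D z -> Dt t y = Dt t z -> y = z.
  move=> ht Dy Dz yz; have [[_ [h [_ hD _]]] _] := diffD t ht.
  by have [_ <-] := hD y Dy; have [_ <-] := hD z Dz; rewrite yz.
have invP t y : 0 <= t <= 1 -> D y -> D (inv t y) /\ Dt t (inv t y) = y.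
  move=> ht Dy; have [[_ [h [_ _ hD]]] _] := diffD t ht.
  rewrite /inv; case: xgetP => [z _ //|] /(_ (h y))[].
  exact: hD.
have invK t z : 0 <= t <= 1 -> D z -> inv t (Dt t z) = z.
  move=> ht Dz; have [[_ [h [_ hD _]]] _] := diffD t ht.
  have [DDz _] := hD z Dz; have [Di Ei] := invP t _ ht DDz.
  exact: (injD t).
pose Q : set (R * C) := `[0, 1] `*` D.
pose P (p : R * C) : R * C := (p.1, Dt p.1 p.2).
have cP : {within Q, continuous P}.
  have cfst : {within Q, continuous (@fst R C)}.
    by apply: continuous_subspaceT => q; exact: cvg_fst.
  by move=> p; exact: (cvg_pair (cfst p) (cDt p)).
have PQ : P @` Q = Q.
  apply/seteqP; split=> [_ [[t y] [/= ht Dy] <-]|[t y] [/= ht Dy]].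
    split => //=; rewrite in_itv /= in ht.
    by have [[_ [h [_ hD _]]] _] := diffD t ht; case: (hD y Dy).
  rewrite in_itv /= in ht; have [Di Ei] := invP t y ht Dy.
  by exists (t, inv t y); [split => //=; rewrite in_itv|rewrite /P /= Ei].
(* [P] maps the compact set [Q] injectively onto itself, so the joint continuity of D_t^-1(y) in t
   and y follows from compactness. *)
have cG : {within P @` Q, continuous (fun p => (p.1, inv p.1 p.2) : R * C)}.
  apply: (@compact_inverse_continuous _ _ Q P) => //.
  - by apply: hausdorff_prod; [exact: Rhausdorff|exact: norm_hausdorff].
  - by apply: compact_setX; [exact: segment_compact|exact: compact_disc].
  - by move=> [t y] [/=]; rewrite in_itv /= => ht Dy; rewrite invK.
rewrite PQ in cG.
(* D_1 is constrained only on the disc; its extension [F] is continuous on the whole plane. *)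
have [[[F sF FE] _] circ1] := diffD 1 I1.
have cF := smooth_continuous sF.
have LD t s : 0 <= t <= 1 -> 0 <= s <= 1 -> D (L (t, s)).
  by move=> ht hs; case: (LX t s ht hs).
pose H (p : R * R) := F (inv (clamp p.1) (L (clamp p.1, clamp p.2))).
have HE t s : 0 <= t <= 1 -> 0 <= s <= 1 -> H (t, s) = Dt 1 (inv t (L (t, s))).
  move=> ht hs; rewrite /H /= !clamp_id // FE //.
  by case: (invP t (L (t, s)) ht (LD t s ht hs)).
apply: (@homotopic_intro _ _ _ _ _ _ _ H).
- pose k (p : R * R) : R * C := (clamp p.1, L (clamp p.1, clamp p.2)).
  have ck : continuous k.
    have c1 : continuous (fun p : R * R => clamp p.1).
      exact: (@continuous_clamped _ _ _ (@cont_fst R)).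
    have c2 := square_clamp_cont cL (@cont_fst R) (@cont_snd R).
    by move=> p; exact: (cvg_pair (c1 p) (c2 p)).
  have := within_comp cG ck; have kQ u : Q (k u).
    by split; rewrite /= ?in_itv /= ?clamp_itv //; apply: LD; exact: clamp_itv.
  move=> /(_ kQ) cGk.
  have cs : continuous (@snd R C) by move=> q; exact: cvg_snd.
  have ci : continuous (fun p : R * R =>
      inv (clamp p.1) (L (clamp p.1, clamp p.2))).
    by move=> p; exact: (continuous_comp (cGk p) (cs _)).
  by move=> p; exact: (continuous_comp (ci p) (cF _)).
- move=> t s ht hs; rewrite HE //; have [Di Ei] := invP t _ ht (LD t s ht hs).
  have [[_ [h [_ hD _]]] _] := diffD 1 I1; split; first by case: (hD _ Di).
  (* A point of [K] is m_i(1) = D_1(m_i(0)); injectivity of D_1 then gives L(t, s) = D_t(m_i(0)) =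
     m_i(t), which is excluded. *)
  rewrite -m1 => -[i _]; rewrite -Dm // => mE.
  have E : m i 0 = inv t (L (t, s)) by apply: (injD 1) => //; exact: mD.
  by have [_ /(_ i)] := LX t s ht hs; apply; rewrite -Dm // E Ei.
- move=> s hs; rewrite !HE //; have [-> ->] := L01 s hs.
  have Df : D (f s) by have [] := path_sub f hs.
  have Dg : D (g s) by have [] := path_sub g hs.
  split; last by case: (invP 1 _ I1 Dg).
  by rewrite /= dE // -{1}(D0 _ Df) invK.
- move=> t ht; rewrite !HE //; have [-> ->] := Lb t ht.
  have [_ /(_ _ (circle_base R)) E] := diffD t ht.
  by rewrite -{1 3}E invK ?circ1 //; [exact: circle_base|exact: disc_base].
Qed.

End Transport.

(** * Smoothness *)

Section Smoothness.
Variable R : realType.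
Local Notation C := (cplx R).

(* A class of functions on the plane that is stable under directional
   derivatives, so that its members are smooth. *)
Inductive term : Type :=
  | TX | TY
  | TCst of R
  | TAdd of term & term
  | TMul of term & term
  | TCos of term
  | TSin of term.

Fixpoint teval (e : term) (p : R * R) : R :=
  match e with
  | TX => p.1
  | TY => p.2
  | TCst c => c
  | TAdd a b => teval a p + teval b p
  | TMul a b => teval a p * teval b p
  | TCos a => cos (teval a p)
  | TSin a => sin (teval a p)
  end.

Fixpoint tderive (v : R * R) (e : term) : term :=
  match e with
  | TX => TCst v.1
  | TY => TCst v.2
  | TCst c => TCst 0
  | TAdd a b => TAdd (tderive v a) (tderive v b)
  | TMul a b => TAdd (TMul a (tderive v b)) (TMul b (tderive v a))
  | TCos a => TMul (TMul (TCst (-1)) (TSin a)) (tderive v a)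
  | TSin a => TMul (TCos a) (tderive v a)
  end.

Lemma is_diff_linear (l : {linear (R * R)%type -> R}) p :
  continuous l -> is_diff p l l.
Proof.
move=> cl; apply: (@is_diff_eq _ _ _ l ('d l p)); last exact: diff_lin.
by apply: differentiableP; exact: linear_differentiable.
Qed.

Lemma is_diff_scalar_comp (f df : R * R -> R) (g g' : R -> R) p :
  is_diff p f df -> (forall x : R, is_derive x 1 g (g' x)) ->
  is_diff p (g \o f) (fun v => g' (f p) * df v).
Proof.
move=> fd gd; have gD (x : R) : differentiable g x by apply/derivable1_diffP;
  exact: ex_derive.
apply: is_diff_eq; first by apply: is_diff_comp; exact: differentiableP.
by apply/funext => v /=; rewrite diff1E // derive1E derive_val mulrC.
Qed.

Lemma is_diff_teval e p : is_diff p (teval e) (fun v => teval (tderive v e) p).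
Proof.
elim: e => [||c|a IHa b IHb|a IHa b IHb|a IHa|a IHa] /=.
- by apply: (@is_diff_linear fst) => q; exact: cvg_fst.
- by apply: (@is_diff_linear snd) => q; exact: cvg_snd.
- exact: is_diff_cst.
- exact: is_diffD.
- exact: is_diffM.
- apply: is_diff_eq; first exact: (is_diff_scalar_comp IHa (@is_derive_cos R)).
  by apply/funext => v; rewrite mulN1r.
- exact: (is_diff_scalar_comp IHa (@is_derive_sin R)).
Qed.

Lemma teval_continuous e : continuous (teval e).
Proof.
move=> p; have h := is_diff_teval e p.
exact: differentiable_continuous.
Qed.

Lemma Ck_teval k e : Ck k (teval e).
Proof.
elim: k e => [|k IHk] e; split; try exact: teval_continuous; first by [].
move=> v; split=> [p|].
  have h := is_diff_teval e p; exact: diff_derivable.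
have -> : 'D_v (teval e) = teval (tderive v e); last exact: IHk.
apply/funext => p; have h := is_diff_teval e p.
by rewrite deriveE // diff_val.
Qed.

Lemma smooth_teval (F : C -> C) (a b : term) :
  (forall p, F (p.1 +i* p.2) = teval a p +i* teval b p) -> smooth F.
Proof.
move=> FE k; split.
  have -> : (fun p => complex.Re (F (p.1 +i* p.2))) = teval a.
    by apply/funext => p; rewrite FE.
  exact: Ck_teval.
have -> : (fun p => complex.Im (F (p.1 +i* p.2))) = teval b.
  by apply/funext => p; rewrite FE.
exact: Ck_teval.
Qed.

End Smoothness.

(** * Loops recorded by their crossings of the real axis *)

Section Reparametrization.
Variables (R : realType) (T : topologicalType) (X : set T).
Variables (x y : T) (f : pathIn R X x y) (u : R -> R).
Hypotheses (cu : continuous u) (u0 : clamp (u 0) = 0) (u1 : clamp (u 1) = 1).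

Lemma reparam_cont : {within `[0, 1], continuous (fun t => f (clamp (u t)))}.
Proof. by apply: continuous_subspaceT; exact: path_clamp_cont. Qed.

Lemma reparam_sub t : 0 <= t <= 1 -> X (f (clamp (u t))).
Proof. by move=> _; apply: path_sub; exact: clamp_itv. Qed.

Lemma reparam_src : f (clamp (u 0)) = x. Proof. by rewrite u0 path_src. Qed.
Lemma reparam_tgt : f (clamp (u 1)) = y. Proof. by rewrite u1 path_tgt. Qed.

Definition path_reparam : pathIn R X x y :=
  PathIn reparam_cont reparam_sub reparam_src reparam_tgt.

Lemma homotopic_path_reparam : homotopic f path_reparam.
Proof.
apply: (@homotopic_reparam _ _ _ _ _ f _ _ _ _ id u) => //.
- exact: cont_id.
- by rewrite u0 clamp_id // lexx ler01.
- by rewrite u1 clamp_id // lexx ler01.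
- by move=> t ht; rewrite clamp_id.
Qed.

End Reparametrization.

(** * Loops crossing the real axis twice *)

Section Connectors.
Variable R : realType.
Local Notation C := (cplx R).
Local Notation D := (@disc R).
Local Notation u0 := (base_pt R).
Local Notation K := (fiber (@curve R) 1).
Local Notation X := (D `\` K).
Local Notation hX := (punctured_base (@fiber1_sub R)).

(* The points of the fiber cut the real axis into five gaps; gap j is the open
   vertical strip over the j-th one. *)
Definition gap (j : nat) (z : C) : Prop :=
  ((0 < j)%N -> j%:R - 3 < complex.Re z) /\
  ((j < 4)%N -> complex.Re z < j%:R - 2).

(** The half planes and the strips are convex and miss the fiber, so a segment joining two points of
    one cell misses it too. *)
Definition same_cell (a b : C) : Prop :=
  [\/ complex.Im a < 0 /\ complex.Im b < 0, 0 < complex.Im a /\ 0 < complex.Im b |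
      exists j, gap j a /\ gap j b].

Lemma ltr_mix (a b c s : R) : 0 <= s <= 1 -> a < c -> b < c ->
  (1 - s) * a + s * b < c.
Proof.
move=> hs ac bc; have [s0|s1] : 0 < s \/ s < 1 by have [|] := ltP 0 s; [left|right;
  lra].
  nra.
nra.
Qed.

Lemma gtr_mix (a b c s : R) : 0 <= s <= 1 -> c < a -> c < b ->
  c < (1 - s) * a + s * b.
Proof. by move=> hs ac bc; have := @ltr_mix (- a) (- b) (- c) s hs; lra. Qed.

Lemma fiber1P z : K z -> exists k : 'I_4, z = (k%:R - 2) +i* 0.
Proof. by rewrite fiber1E => -[k _ <-]; exists k. Qed.

Lemma not_fiber1 z : complex.Im z != 0 \/ (exists j, gap j z) -> ~ K z.
Proof.
move=> h /fiber1P[k zE]; case: h; rewrite zE /= ?eqxx // => -[j [/= h1 h2]].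
have [kj|jk] := ltnP k j.
  have := h1 (leq_ltn_trans (leq0n _) kj).
  have : (k.+1%:R : R) <= j%:R by rewrite ler_nat.
  by rewrite -natr1; lra.
have := h2 (leq_ltn_trans jk (ltn_ord k)).
have : (j%:R : R) <= k%:R by rewrite ler_nat.
lra.
Qed.

Lemma homotopic_straight a b (f g : pathIn R X a b) :
  (forall t, 0 <= t <= 1 -> same_cell (f t) (g t)) -> homotopic f g.
Proof.
move=> fg.
pose re (h : pathIn R X a b) (p : R * R) := complex.Re (h (clamp p.2)).
pose im (h : pathIn R X a b) (p : R * R) := complex.Im (h (clamp p.2)).
have cre h : continuous (re h).
  have ch : continuous (fun p : R * R => h (clamp p.2)).
    exact: path_clamp_cont (@cont_snd R).
  by move=> p; exact: (continuous_comp (ch p) (@continuous_Re R _)).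
have cim h : continuous (im h).
  have ch : continuous (fun p : R * R => h (clamp p.2)).
    exact: path_clamp_cont (@cont_snd R).
  by move=> p; exact: (continuous_comp (ch p) (@continuous_Im R _)).
apply: (@homotopic_intro _ _ _ _ _ _ _ (fun p =>
   ((1 - p.1) * re f p + p.1 * re g p) +i* ((1 - p.1) * im f p + p.1 * im g p) : C)).
- by apply: continuous_complex; exact: continuous_mix.
- move=> s t hs ht; rewrite /re /im /= clamp_id //; split.
    have [/discE Df _] := path_sub f ht; have [/discE Dg _] := path_sub g ht.
    apply/discE => /=; move: (complex.Re (f t)) (complex.Re (g t)) Df Dg => x1 x2.
    move: (complex.Im (f t)) (complex.Im (g t)) => y1 y2 Df Dg.
    (* This identity expresses the convexity of the squared modulus and keeps the segment in the
       disc. *)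
    have e : ((1 - s) * x1 + s * x2) ^+ 2 + ((1 - s) * y1 + s * y2) ^+ 2 =
      (1 - s) * (x1 ^+ 2 + y1 ^+ 2) + s * (x2 ^+ 2 + y2 ^+ 2)
      - s * (1 - s) * ((x1 - x2) ^+ 2 + (y1 - y2) ^+ 2) by ring.
    have := sqr_ge0 (x1 - x2); have := sqr_ge0 (y1 - y2) => h1 h2.
    have : 0 <= s * (1 - s) * ((x1 - x2) ^+ 2 + (y1 - y2) ^+ 2).
      by apply: mulr_ge0; [apply: mulr_ge0; lra|lra].
    rewrite e; nra.
  apply: not_fiber1; case: (fg t ht) => [[h1 h2]|[h1 h2]|[j [[h1 h2] [h3 h4]]]].
  - by left; rewrite lt_eqF //=; exact: ltr_mix.
  - by left; rewrite gt_eqF //=; exact: gtr_mix.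
  - right; exists j; split => /= hj.
      by apply: gtr_mix; [|exact: h1|exact: h3].
    by apply: ltr_mix; [|exact: h2|exact: h4].
- move=> t ht; rewrite /re /im /= clamp_id // !subr0 !subrr !mul1r !mul0r !addr0 !add0r.
  by case: (f t) (g t) => [? ?] [? ?].
- move=> s hs; rewrite /re /im /= !clamp_id ?lexx ?ler01 // !path_src !path_tgt.
  by rewrite -!mulrDl !subrK !mul1r; case: (a) (b) => [? ?] [? ?].
Qed.

Definition top_pt : C := 0 +i* 4.

(* The path from the bottom to the top of the disc through the middle of gap j. *)
Definition connector_fun (j : 'I_5) (t : R) : C :=
  ((j%:R - 5 / 2) * (4 * t * (1 - t))) +i* (8 * t - 4).

(** On this interval 4t(1 - t) lies between 24/25 and 1, so the real part is within 1/10 of the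
    midpoint j - 5/2 of the gap. *)
Lemma connector_gap (j : 'I_5) (t : R) :
  2 / 5 <= t <= 3 / 5 -> gap j (connector_fun j t).
Proof.
move=> ht; have j0 : (0 : R) <= j%:R by [].
have j4 : (j%:R : R) <= 4 by rewrite ler_nat -ltnS ltn_ord.
have w1 : 24 / 25 <= 4 * t * (1 - t).
  have : 0 <= (t - 2 / 5) * (3 / 5 - t) by apply: mulr_ge0; lra.
  lra.
have w2 : 4 * t * (1 - t) <= 1 by have := sqr_ge0 (2 * t - 1); lra.
by split=> _ /=; nra.
Qed.

Lemma connector_sub (j : 'I_5) t : 0 <= t <= 1 -> X (connector_fun j t).
Proof.
move=> ht; have j0 : (0 : R) <= j%:R by [].
have j4 : (j%:R : R) <= 4 by rewrite ler_nat -ltnS ltn_ord.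
split.
  apply/discE => /=; have p0 : 0 <= t * (1 - t) by apply: mulr_ge0; lra.
  have p1 : t * (1 - t) <= 1 / 4 by have := sqr_ge0 (2 * t - 1); lra.
  have c2 : (j%:R - 5 / 2 : R) ^+ 2 <= 25 / 4.
    have : 0 <= (j%:R : R) * (5 - j%:R) by apply: mulr_ge0; lra.
    lra.
  have -> : ((j%:R - 5 / 2) * (4 * t * (1 - t))) ^+ 2 + (8 * t - 4) ^+ 2 =
    16 - 64 * (t * (1 - t)) + 16 * ((j%:R - 5 / 2) ^+ 2 * (t * (1 - t)) ^+ 2) by ring.
  move: (t * (1 - t)) ((j%:R - 5 / 2) ^+ 2) p0 p1 c2 => p c p0 p1 c2.
  have pp : 0 <= p * (1 / 4 - p) by apply: mulr_ge0; lra.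
  have cp : 0 <= (25 / 4 - c) * p ^+ 2 by apply: mulr_ge0; [lra|exact: sqr_ge0].
  lra.
apply: not_fiber1 => /=; have [->|h] := eqVneq t 2^-1; last by left; lra.
by right; exists j; apply: connector_gap; lra.
Qed.

Lemma connector_cont j : {within `[0, 1], continuous (connector_fun j)}.
Proof.
apply: continuous_subspaceT; apply: continuous_complex => t.
  apply: cvgM; first exact: cvg_cst.
  apply: cvgM; first by apply: cvgM; [exact: cvg_cst|exact: cvg_id].
  by apply: cvgB; [exact: cvg_cst|exact: cvg_id].
apply: cvgB; last exact: cvg_cst.
by apply: cvgM; [exact: cvg_cst|exact: cvg_id].
Qed.

Lemma connector0 j : connector_fun j 0 = u0.
Proof. by rewrite /connector_fun !mulr0 mul0r mulr0 sub0r. Qed.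

Lemma connector1 j : connector_fun j 1 = top_pt.
Proof.
rewrite /connector_fun /top_pt subrr !mulr0 mulr1.
by have -> : 8 - 4 = 4 :> R by lra.
Qed.

Definition connector j : pathIn R X u0 top_pt :=
  PathIn (@connector_cont j) (@connector_sub j) (connector0 j) (connector1 j).

Definition connector_loop j i := path_cat (connector j) (path_rev (connector i)).

Lemma top_sub : X top_pt.
Proof. by rewrite -(connector1 ord0); apply: connector_sub; rewrite ler01 lexx. Qed.

Lemma connector_loopM i j k :
  (pi1_class hX (connector_loop i j) * pi1_class hX (connector_loop j k))%g =
  pi1_class hX (connector_loop i k).
Proof. by rewrite pi1_classM; apply/pi1_classP/cat_rev_cancel/top_sub. Qed.

(** A reparametrization makes [f] cross the axis together with the connector loop, which by
    [connector_gap] is in gap [j] on [1/5, 3/10] and in gap [i] on [7/10, 4/5]. At each time both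
    loops are then in one cell and [homotopic_straight] applies. *)
Lemma homotopic_connector_loop (j i : 'I_5) (f : pathIn R X u0 u0) (a1 a2 a3 a4 : R) :
  [&& 0 <= a1, a1 <= a2, a2 <= a3, a3 <= a4 & a4 <= 1] ->
  (forall t, 0 <= t <= a1 -> complex.Im (f t) < 0) ->
  (forall t, a1 <= t <= a2 -> gap j (f t)) ->
  (forall t, a2 <= t <= a3 -> 0 < complex.Im (f t)) ->
  (forall t, a3 <= t <= a4 -> gap i (f t)) ->
  (forall t, a4 <= t <= 1 -> complex.Im (f t) < 0) ->
  homotopic f (connector_loop j i).
Proof.
move=> /and5P[h0 h1 h2 h3 h4] f1 f2 f3 f4 f5.
(* maps [0, 1/5], [1/5, 3/10], [3/10, 7/10], [7/10, 4/5] and [4/5, 1] to the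
   intervals cut out by a1, a2, a3 and a4 *)
pose r (t : R) := a1 * clamp (5 * t + 0) + (a2 - a1) * clamp (10 * t + (- 2))
  + (a3 - a2) * clamp (5 / 2 * t + (- (3 / 4))) + (a4 - a3) * clamp (10 * t + (- 7))
  + (1 - a4) * clamp (5 * t + (- 4)).
have clr := @clamp_le0 R; have cll := @clamp_ge1 R.
have cr : continuous r.
  have cc a b : continuous (fun t : R => clamp (a * t + b)).
    by apply: (@continuous_clamp_affine _ _ id); exact: cont_id.
  move=> t; repeat (apply: cvgD; [|by apply: cvgM; [exact: cvg_cst|exact: cc]]).
  by apply: cvgM; [exact: cvg_cst|exact: cc].
have r0 : clamp (r 0) = 0.
  suff -> : r 0 = 0 by rewrite clamp_id // lexx ler01.
  by rewrite /r !clr ?mulr0 ?addr0 //; lra.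
have r1 : clamp (r 1) = 1.
  suff -> : r 1 = 1 by rewrite clamp_id // lexx ler01.
  by rewrite /r !cll; lra.
apply: homotopic_trans (homotopic_path_reparam f cr r0 r1) _.
apply: homotopic_straight => t ht /=.
have rho1 : t <= 1 / 5 -> 0 <= clamp (r t) <= a1.
  move=> t1; rewrite /r
    (clr (10 * t + (- 2))) ?(clr (5 / 2 * t + _))
    ?(clr (10 * t + (- 7))) ?(clr (5 * t + (- 4)));
    [|lra..].
  have := clamp_itv (5 * t + 0); set c := clamp _ => hc.
  by rewrite clamp_id; nra.
have rho2 : 1 / 5 <= t <= 3 / 10 -> a1 <= clamp (r t) <= a2.
  move=> t1; rewrite /r
    (cll (5 * t + 0)) ?(clr (5 / 2 * t + _)) ?(clr (10 * t + (- 7)))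
      ?(clr (5 * t + (- 4)));
    [|lra..].
  have := clamp_itv (10 * t + (- 2)); set c := clamp _ => hc.
  by rewrite clamp_id; nra.
have rho3 : 3 / 10 <= t <= 7 / 10 -> a2 <= clamp (r t) <= a3.
  move=> t1; rewrite /r
    (cll (5 * t + 0)) ?(cll (10 * t + (- 2)))
    ?(clr (10 * t + (- 7))) ?(clr (5 * t + (- 4)));
    [|lra..].
  have := clamp_itv (5 / 2 * t + (- (3 / 4))); set c := clamp _ => hc.
  by rewrite clamp_id; nra.
have rho4 : 7 / 10 <= t <= 4 / 5 -> a3 <= clamp (r t) <= a4.
  move=> t1; rewrite /r
    (cll (5 * t + 0)) ?(cll (10 * t + (- 2))) ?(cll (5 / 2 * t + _))
      ?(clr (5 * t + (- 4)));
    [|lra..].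
  have := clamp_itv (10 * t + (- 7)); set c := clamp _ => hc.
  by rewrite clamp_id; nra.
have rho5 : 4 / 5 <= t -> a4 <= clamp (r t) <= 1.
  move=> t1; rewrite /r
    (cll (5 * t + 0)) ?(cll (10 * t + (- 2)))
    ?(cll (5 / 2 * t + _)) ?(cll (10 * t + (- 7)));
    [|lra..].
  have := clamp_itv (5 * t + (- 4)); set c := clamp _ => hc.
  by rewrite clamp_id; nra.
rewrite /cat_fun /=; case: (leP t 2^-1) => t2.
  have [t1|t1] := leP t (1 / 5).
    by apply: Or31; split; [apply: f1; exact: rho1|rewrite /=; lra].
  have [t3|t3] := leP t (3 / 10).
    apply: Or33; exists j; split; first by apply: f2; apply: rho2; lra.
    by apply: connector_gap; lra.
  by apply: Or32; split; [apply: f3; apply: rho3; lra|rewrite /=; lra].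
have [t1|t1] := leP t (7 / 10).
  by apply: Or32; split; [apply: f3; apply: rho3; lra|rewrite /=; lra].
have [t3|t3] := leP t (4 / 5).
  apply: Or33; exists i; split; first by apply: f4; apply: rho4; lra.
  by apply: connector_gap; lra.
by apply: Or31; split; [apply: f5; apply: rho5; lra|rewrite /=; lra].
Qed.

End Connectors.

(** * Signs and sizes of sine and cosine on quarter turns *)

Section Quadrants.
Variable R : realType.
Implicit Types t x y : R.

Lemma sqr_le_itv x y : 0 <= y -> x ^+ 2 <= y ^+ 2 -> - y <= x <= y.
Proof. by move=> y0 xy;
  rewrite -ler_norml -ler_sqr ?nnegrE // real_normK ?num_real. Qed.

(** The cosine of the doubled angle is nonnegative here, so sin^2 <= cos^2 and cos^2 >= 1/2; 7/10 is
    a rational lower bound of 1/sqrt 2. *)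
Lemma cos_quadrant t : - (1 / 8) <= t <= 1 / 8 ->
  7 / 10 <= cos (2 * pi * t) /\ sin (2 * pi * t) ^+ 2 <= cos (2 * pi * t) ^+ 2.
Proof.
move=> ht; have pi0 := pi_gt0 R.
have h1 : 0 <= pi * (1 / 8 - t) by apply: mulr_ge0; lra.
have h2 : 0 <= pi * (t + 1 / 8) by apply: mulr_ge0; lra.
have c0 : 0 < cos (2 * pi * t) by apply: cos_gt0_pihalf; lra.
have : 0 <= cos ((2 * pi * t) *+ 2) by apply: cos_ge0_pihalf; lra.
have := cos2Dsin2 (2 * pi * t); rewrite cos_mulr2n.
move: c0; set c := cos _; set s := sin _ => c0 cs c1.
have s1 : s ^+ 2 <= c ^+ 2 by lra.
split=> //; rewrite leNgt; apply/negP => c2.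
have : c * c < 7 / 10 * (7 / 10) by apply: ltr_pM => //; exact: ltW.
lra.
Qed.

Lemma cosBpi x : cos (x - pi) = - cos x.
Proof. by rewrite cosB cospi sinpi mulr0 addr0 mulrN1. Qed.

Lemma sinBpi x : sin (x - pi) = - sin x.
Proof. by rewrite sinB cospi sinpi mulr0 subr0 mulrN1. Qed.

(** [cos_quadrant] shifted by multiples of 1/4. The intervals are the times which a counterclockwise
    circle started at its lowest point spends near the bottom, right, top, left and bottom again. *)
Lemma quadrants t : let c := cos (2 * pi * t) in let s := sin (2 * pi * t) in
  [/\ (t <= 1 / 8 -> 0 <= t -> 7 / 10 <= c /\ s ^+ 2 <= c ^+ 2),
      (1 / 8 <= t <= 3 / 8 -> 7 / 10 <= s /\ c ^+ 2 <= s ^+ 2),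
      (3 / 8 <= t <= 5 / 8 -> c <= - (7 / 10) /\ s ^+ 2 <= c ^+ 2),
      (5 / 8 <= t <= 7 / 8 -> s <= - (7 / 10) /\ c ^+ 2 <= s ^+ 2) &
      (7 / 8 <= t <= 1 -> 7 / 10 <= c /\ s ^+ 2 <= c ^+ 2)].
Proof.
move=> c s; split=> ht.
- by move=> t0; apply: cos_quadrant; lra.
- have := @cos_quadrant (t - 1 / 4);
  have -> : 2 * pi * (t - 1 / 4) = 2 * pi * t - pi / 2 by field.
  by rewrite cosBpihalf sinBpihalf sqrrN; apply; lra.
- have := @cos_quadrant (t - 1 / 2);
  have -> : 2 * pi * (t - 1 / 2) = 2 * pi * t - pi by field.
  rewrite cosBpi sinBpi !sqrrN -/c -/s => -[|h1 h2]; first by lra.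
  by split=> //; lra.
- have := @cos_quadrant (t - 3 / 4).
  have -> : 2 * pi * (t - 3 / 4) = 2 * pi * t - pi / 2 - pi by field.
  rewrite cosBpi sinBpi cosBpihalf sinBpihalf !sqrrN -/c -/s => -[|h1 h2]; first by lra.
  by split=> //; lra.
- have := @cos_quadrant (t - 1).
  have -> : 2 * pi * (t - 1) = 2 * pi * t - pi - pi by ring.
  by rewrite !(cosBpi, sinBpi) !opprK; apply; lra.
Qed.

End Quadrants.

(** * The g-base in terms of crossings *)

Section GbaseLoops.
Variable R : realType.
Local Notation C := (cplx R).
Local Notation D := (@disc R).
Local Notation u0 := (base_pt R).
Local Notation K := (fiber (@curve R) 1).
Local Notation X := (D `\` K).
Local Notation hX := (punctured_base (@fiber1_sub R)).

(** [fiber_pt i] separates gap [i] from gap [i + 1]. *)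
Definition right_gap (i : 'I_4) : 'I_5 := lift ord0 i.
Definition left_gap (i : 'I_4) : 'I_5 := widen_ord (leqnSn 4) i.

Lemma gbase_segment_lower (i : 'I_4) (t : R) : 0 <= t <= 1 ->
  complex.Im (gbase_segment_fun i t) < 0.
Proof. by move=> ht; rewrite gbase_segment_coord /=; lra. Qed.

Lemma gbase_circle_cells (i : 'I_4) (t : R) : 0 <= t <= 1 ->
  [/\ t <= 1 / 8 -> complex.Im (gbase_circle_fun i t) < 0,
      1 / 8 <= t <= 3 / 8 -> gap (right_gap i) (gbase_circle_fun i t),
      3 / 8 <= t <= 5 / 8 -> 0 < complex.Im (gbase_circle_fun i t),
      5 / 8 <= t <= 7 / 8 -> gap (left_gap i) (gbase_circle_fun i t) &
      7 / 8 <= t -> complex.Im (gbase_circle_fun i t) < 0].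
Proof.
move=> ht; rewrite gbase_circle_coord /=; have [q1 q2 q3 q4 q5] := quadrants t.
have a4 := fiber_pt_bound R i; have cs := cos2Dsin2 (2 * pi * t).
have aE : (right_gap i)%:R = (i%:R - 2) + 3 :> R
  by rewrite /= /bump leq0n add1n -natr1; lra.
have aE' : (left_gap i)%:R = (i%:R - 2) + 2 :> R by rewrite /=; lra.
move: (i%:R - 2) a4 aE aE' => a a4 aE aE'.
move: (cos _) (sin _) cs q1 q2 q3 q4 q5 => c s cs q1 q2 q3 q4 q5.
(* As |a| <= 2, the terms in a/10 are at most half of the dominating terms in 2/5, so the tilt of
   the starting point does not change the signs. *)
have bound x y : x ^+ 2 <= y ^+ 2 -> 0 <= y -> - (2 * y) <= a * x <= 2 * y.
  move=> xy y0; apply: sqr_le_itv; first lra.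
  rewrite !exprMn; apply: ler_pM => //; [exact: sqr_ge0|exact: sqr_ge0|lra].
split=> h.
- have [c0 sc] := q1 h (proj1 (andP ht)).
  by have := bound _ _ sc (le_trans _ c0); lra.
- have [s0 sc] := q2 h; have b := bound _ _ sc (le_trans _ s0); split=> _ /=.
    rewrite aE; lra.
  rewrite aE; have : s <= 1 by have := sqr_ge0 c; nra.
  lra.
- have [c0 sc] := q3 h.
  by have := bound s (- c); rewrite sqrrN => /(_ sc); lra.
- have [s0 sc] := q4 h; have b := bound c (- s); rewrite sqrrN in b.
  have {}b := b sc.
  have s1 : - s <= 1 by have := sqr_ge0 c; nra.
  by split=> _ /=; rewrite aE'; lra.
- have [c0 sc] := q5 (introT andP (conj h (proj2 (andP ht)))).
  by have := bound _ _ sc (le_trans _ c0); lra.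
Qed.

Lemma gbase_loopE (i : 'I_4) t : gbase_loop R i t =
  if t <= 1 / 4 then gbase_segment_fun i (4 * t)
  else if t <= 1 / 2 then gbase_circle_fun i (4 * t - 1)
  else gbase_segment_fun i (2 - 2 * t).
Proof.
rewrite /= /cat_fun /= /cat_fun; case: (leP t 2^-1) => h1.
  rewrite (_ : (t <= 1 / 2) = true) //; last by apply/idP; lra.
  case: (leP (2 * t)) => h2; case: (leP t) => h3; try by exfalso; lra.
    by congr (gbase_segment_fun _ _); lra.
  by congr (gbase_circle_fun _ _); lra.
rewrite (_ : (t <= 1 / 2) = false) //; last by apply/negbTE; rewrite -ltNge; lra.
rewrite (_ : (t <= 1 / 4) = false) //; last by apply/negbTE; rewrite -ltNge; lra.
by congr (gbase_segment_fun _ _); lra.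
Qed.

Lemma homotopic_gbase_loop (i : 'I_4) :
  homotopic (gbase_loop R i) (connector_loop R (right_gap i) (left_gap i)).
Proof.
(* The circle occupies the times from 1/4 to 1/2 with parameter 4t - 1, which is 1/8, 3/8, 5/8, 7/8
   at these times. *)
apply: (@homotopic_connector_loop _ _ _ _ (9 / 32) (11 / 32) (13 / 32) (15 / 32)).
- lra.
- move=> t ht; rewrite gbase_loopE; case: (leP t (1 / 4)) => h1.
    by apply: gbase_segment_lower; lra.
  rewrite ifT; last lra.
  have [|h _ _ _ _] := @gbase_circle_cells i (4 * t - 1); first lra.
  by apply: h; lra.
- move=> t ht; rewrite gbase_loopE ifF; last by apply/negbTE; rewrite -ltNge; lra.
  rewrite ifT; last lra.
  have [|_ h _ _ _] := @gbase_circle_cells i (4 * t - 1); first lra.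
  by apply: h; lra.
- move=> t ht; rewrite gbase_loopE ifF; last by apply/negbTE; rewrite -ltNge; lra.
  rewrite ifT; last lra.
  have [|_ _ h _ _] := @gbase_circle_cells i (4 * t - 1); first lra.
  by apply: h; lra.
- move=> t ht; rewrite gbase_loopE ifF; last by apply/negbTE; rewrite -ltNge; lra.
  rewrite ifT; last lra.
  have [|_ _ _ h _] := @gbase_circle_cells i (4 * t - 1); first lra.
  by apply: h; lra.
- move=> t ht; rewrite gbase_loopE ifF; last by apply/negbTE; rewrite -ltNge; lra.
  case: (leP t (1 / 2)) => h1; last by apply: gbase_segment_lower; lra.
  have [|_ _ _ _ h] := @gbase_circle_cells i (4 * t - 1); first lra.
  by apply: h; lra.
Qed.

Lemma gbaseE (i : 'I_4) : gbase R i =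
  pi1_class hX (connector_loop R (right_gap i) (left_gap i)).
Proof. by apply/pi1_classP; exact: homotopic_gbase_loop. Qed.

(** Each generator goes up through the gap on the right of its point and down through the gap on its
    left, so the product telescopes to a loop around -1, 0 and 1. *)
Lemma gbase_prod_inner :
  (gbase R (inord 3) * gbase R (inord 2) * gbase R (inord 1))%g =
  pi1_class hX (connector_loop R (inord 4) (inord 1)).
Proof.
have e k : (k < 4)%N -> right_gap (inord k) = inord k.+1.
  by move=> k4; apply/val_inj; rewrite /= /bump !inordK.
have e' k : (k < 4)%N -> left_gap (inord k) = inord k.
  by move=> k4; apply/val_inj; rewrite /= !inordK // ltnW.
by rewrite !gbaseE !e // !e' // !connector_loopM.
Qed.

Lemma gbase_prod_outer :
  (gbase R (inord 3) * gbase R (inord 2) * gbase R (inord 1) * gbase R (inord 0))%g =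
  pi1_class hX (connector_loop R (inord 4) (inord 0)).
Proof.
rewrite gbase_prod_inner gbaseE.
have -> : right_gap (inord 0) = inord 1.
  by apply/val_inj; rewrite /= /bump !inordK.
have -> : left_gap (inord 0) = inord 0 by apply/val_inj; rewrite /= !inordK.
by rewrite connector_loopM.
Qed.

End GbaseLoops.

(** * Spins *)

Section Spin.
Variable R : realType.
Local Notation C := (cplx R).
Local Notation D := (@disc R).
Local Notation u0 := (base_pt R).
Local Notation K := (fiber (@curve R) 1).
Local Notation X := (D `\` K).
Local Notation hK := (@fiber1_sub R).
Local Notation hX := (punctured_base hK).
Local Notation loop := (pathIn R X u0 u0).

Definition nsq (y : C) : R := complex.Re y ^+ 2 + complex.Im y ^+ 2.

Lemma nsqM (y z : C) : nsq (y * z) = nsq y * nsq z.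
Proof. by case: y z => [a b] [c d]; rewrite /nsq /=; ring. Qed.

Lemma nsq_expi a : nsq (expi a) = 1.
Proof. exact: cos2Dsin2. Qed.

Lemma nsqR (a : R) : nsq a%:C = a ^+ 2.
Proof. by rewrite /nsq /= expr0n addr0. Qed.

Lemma nsq_ge0 y : 0 <= nsq y.
Proof. by apply: addr_ge0; exact: sqr_ge0. Qed.

Lemma nsq_disc y : D y <-> nsq y <= 16.
Proof. exact: discE. Qed.

Lemma nsq_circle y : circle y -> nsq y = 16.
Proof.
rewrite /circle /= normc_def => h.
have {h} /(congr1 (@complex.Re R)) /= h :
    (Num.sqrt (complex.Re y ^+ 2 + complex.Im y ^+ 2))%:C = (4 : R)%:C.
  by rewrite h rmorph_nat.
by rewrite -(sqr_sqrtr (nsq_ge0 y)) /nsq h; lra.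
Qed.

Lemma nsq_base : nsq u0 = 16.
Proof. exact/nsq_circle/circle_base. Qed.

Lemma nsq_fiber_pt (i : 'I_4) : nsq (fiber_pt R i) = (i%:R - 2) ^+ 2.
Proof. exact: nsqR. Qed.

Lemma nsq_fiber1 z : K z -> [\/ z = 0, nsq z = 1 | nsq z = 4].
Proof.
move=> /fiber1P[k ->]; rewrite /nsq /= expr0n addr0.
case: k => -[|[|[|[|//]]]] /= _; [apply: Or33; lra|apply: Or32; lra| |apply: Or32; lra].
by apply: Or31; rewrite subrr.
Qed.

Lemma expiD (a b : R) : expi (a + b) = expi a * expi b :> C.
Proof.
by rewrite /expi cosD sinD; apply/eqP; rewrite eq_complex /=; apply/andP; split;
  apply/eqP; ring.
Qed.

Lemma expi_pi2n n : expi (2 * pi * n%:R) = 1 :> C.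
Proof.
elim: n => [|n IHn]; first by rewrite mulr0 expi0.
by rewrite -[n.+1%:R]natr1 mulrDr expiD IHn mul1r mulr1 expi2pi.
Qed.

Lemma expi_neq0 a : expi a != 0 :> C.
Proof.
apply/eqP => /(congr1 nsq); rewrite nsq_expi /nsq /= expr0n addr0 => /eqP.
by rewrite oner_eq0.
Qed.

Lemma continuous_nsq : continuous nsq.
Proof.
have cR := @continuous_Re R; have cI := @continuous_Im R.
move=> z; have FF : Filter (nbhs z) by apply: _.
by apply: cvgD; rewrite expr2; apply: cvgM; [exact: cR|exact: cR|exact: cI|exact: cI].
Qed.

Lemma continuous_mul_expi (U : topologicalType) (g : U -> C) (h : U -> R) :
  continuous g -> continuous h -> continuous (fun u => g u * expi (h u)).
Proof.
move=> cg ch u; apply: cvgM; first exact: cg.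
exact: (continuous_comp (ch u) (@continuous_expi R _)).
Qed.

(** Dependence on |y|^2 instead of |y| keeps the map smooth at the origin for polynomial [th]. *)
Definition spin (th : R -> R) (y : C) : C := y * expi (th (nsq y)).

Lemma nsq_spin th y : nsq (spin th y) = nsq y.
Proof. by rewrite /spin nsqM nsq_expi mulr1. Qed.

Lemma spinK th ph y : (forall q, th q + ph q = 0) -> spin ph (spin th y) = y.
Proof. by move=> h; rewrite /spin nsqM nsq_expi mulr1 -mulrA -expiD h expi0 mulr1. Qed.

Lemma spin_inj th : injective (spin th).
Proof.
by apply: (@can_inj _ _ _ (spin (fun q => - th q))) => y; apply: spinK => q;
  rewrite subrr.
Qed.

Lemma spin_fix th y : expi (th (nsq y)) = 1 :> C -> spin th y = y.
Proof. by move=> e; rewrite /spin e mulr1. Qed.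

(** The fiber consists of 0 and points of |y| = 1 and |y| = 2, and the spin fixes 0 and both circles
    pointwise. *)
Lemma spin_fiber1 th y : expi (th 1) = 1 :> C -> expi (th 4) = 1 :> C ->
  K (spin th y) -> spin th y = y.
Proof.
move=> e1 e4 Ky; have [/eqP|n1|n4] := nsq_fiber1 Ky.
- by rewrite /spin mulf_eq0 (negbTE (expi_neq0 _)) orbF => /eqP ->; rewrite mul0r.
- by apply: spin_fix; rewrite -(nsq_spin th) n1.
- by apply: spin_fix; rewrite -(nsq_spin th) n4.
Qed.

Lemma spin_sub th y : expi (th 1) = 1 :> C -> expi (th 4) = 1 :> C ->
  X y -> X (spin th y).
Proof.
move=> e1 e4 [Dy nKy]; split; first by apply/nsq_disc; rewrite nsq_spin; exact/nsq_disc.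
by move=> Ks; apply: nKy; rewrite -(spin_fiber1 e1 e4 Ks).
Qed.

Lemma smooth_spin (a b c : R) : smooth (spin (fun q => a + b * q + c * (q * q))).
Proof.
pose q := TAdd (TMul (TX R) (TX R)) (TMul (TY R) (TY R)).
pose th := TAdd (TAdd (TCst a) (TMul (TCst b) q)) (TMul (TCst c) (TMul q q)).
apply: (@smooth_teval _ _
   (TAdd (TMul (TX R) (TCos th)) (TMul (TCst (-1)) (TMul (TY R) (TSin th))))
   (TAdd (TMul (TX R) (TSin th)) (TMul (TY R) (TCos th)))) => p.
by rewrite /spin /expi /nsq /= mulN1r.
Qed.

Lemma spin_disc_diffeo (a b c : R) :
  is_disc_diffeo (spin (fun q => a + b * q + c * (q * q))).
Proof.
have sm (a' b' c' : R) : smooth_on_disc (spin (fun q => a' + b' * q + c' * (q * q))).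
  by exists (spin (fun q => a' + b' * q + c' * (q * q))) => //; exact: smooth_spin.
split=> //; exists (spin (fun q => (- a) + (- b) * q + (- c) * (q * q))).
split=> [//|y Dy|y Dy]; (split; first by apply/nsq_disc; rewrite nsq_spin;
  exact/nsq_disc);
  by apply: spinK => q; ring.
Qed.

(* The angle of the rotation of the circle |y|^2 = q: it is 4 pi a at q = 1,
   2 pi b at q = 4, and 0 at q = 16. *)
Definition angle (a b q : R) : R :=
  4 * pi / 45 * a * ((q - 4) * (q - 16)) + 2 * pi / 36 * b * ((q - 1) * (16 - q)).

Lemma angle1 a b : angle a b 1 = 4 * pi * a. Proof. by rewrite /angle; field. Qed.
Lemma angle4 a b : angle a b 4 = 2 * pi * b. Proof. by rewrite /angle; field. Qed.
Lemma angle16 a b : angle a b 16 = 0. Proof. by rewrite /angle; field. Qed.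

Lemma continuous_angle (U : topologicalType) (a b q : U -> R) :
  continuous a -> continuous b -> continuous q ->
  continuous (fun u => angle (a u) (b u) (q u)).
Proof.
move=> ca cb cq u; have cqc c : (fun u => q u - c) @ u --> q u - c.
  by apply: cvgB; [exact: cq|exact: cvg_cst].
apply: cvgD; apply: cvgM.
- by apply: cvgM; [exact: cvg_cst|exact: ca].
- by apply: cvgM; exact: cqc.
- by apply: cvgM; [exact: cvg_cst|exact: cb].
- by apply: cvgM; [exact: cqc|apply: cvgB; [exact: cvg_cst|exact: cq]].
Qed.

Lemma angle_disc_diffeo a b : is_disc_diffeo (spin (angle a b)).
Proof.
have -> : angle a b = fun q : R => (4 * pi / 45 * a * 64 - 2 * pi / 36 * b * 16)
   + (2 * pi / 36 * b * 17 - 4 * pi / 45 * a * 20) * q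
   + (4 * pi / 45 * a - 2 * pi / 36 * b) * (q * q).
  by apply/funext => q; rewrite /angle; ring.
exact: spin_disc_diffeo.
Qed.

Lemma angle_circle a b y : circle y -> spin (angle a b) y = y.
Proof. by move=> /nsq_circle y16; apply: spin_fix; rewrite y16 angle16 expi0. Qed.

Lemma expi_angle11 q : q = 1 \/ q = 4 -> expi (angle 1 1 q) = 1 :> C.
Proof.
case=> ->; first by rewrite angle1 -[RHS](expi_pi2n 2); congr expi; ring.
by rewrite angle4 -[RHS](expi_pi2n 1).
Qed.

Lemma twist_fix_fiber1 y : K y -> spin (angle 1 1) y = y.
Proof.
move=> /nsq_fiber1[->|n1|n4]; first by rewrite /spin mul0r.
  by apply: spin_fix; apply: expi_angle11; left.
by apply: spin_fix; apply: expi_angle11; right.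
Qed.

Lemma twist_fiber1 : spin (angle 1 1) @` K = K.
Proof.
apply/seteqP; split=> [_ [y Ky <-]|y Ky]; first by rewrite twist_fix_fiber1.
by exists y => //; exact: twist_fix_fiber1.
Qed.

Definition twist_diffeo : kdiffeo K :=
  KDiffeo (angle_disc_diffeo 1 1) twist_fiber1 (@angle_circle 1 1).

Definition twist_braid : braid hK := braid_class hK twist_diffeo.

Section Motion.
Variables a b : R -> R.
Hypotheses (ca : continuous a) (cb : continuous b).
Hypotheses (a0 : a 0 = 0) (b0 : b 0 = 0) (a1 : a 1 = 1) (b1 : b 1 = 1).

(** [a] and [b] are the time laws of the inner points and of -2: both are the identity for the
    monodromy, and ramps over the two halves of [0, 1] for the motion in two stages. *)
Definition spin_motion (i : 'I_4) (t : R) : C :=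
  spin (angle (a t) (b t)) (fiber_pt R i).

Lemma angle00 q : angle 0 0 q = 0.
Proof. by rewrite /angle !mulr0 !mul0r addr0. Qed.

Lemma fiber_pt_fiber1 i : K (fiber_pt R i).
Proof. by rewrite fiber1E; exists i. Qed.

Lemma fiber_pt_inj : injective (@fiber_pt R).
Proof.
move=> i j /(congr1 (@complex.Re R)) /= /addIr/eqP; rewrite eqr_nat => /eqP.
exact: val_inj.
Qed.

Lemma spin_motion_cont i : continuous (spin_motion i).
Proof.
apply: continuous_mul_expi; first by move=> t; exact: cvg_cst.
by apply: continuous_angle => // t; exact: cvg_cst.
Qed.

Lemma spin_motion0 i : spin_motion i 0 = fiber_pt R i.
Proof. by rewrite /spin_motion a0 b0; apply: spin_fix; rewrite angle00 expi0. Qed.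

Lemma spin_motion1 i : spin_motion i 1 = fiber_pt R i.
Proof. by rewrite /spin_motion a1 b1; apply: twist_fix_fiber1;
  exact: fiber_pt_fiber1. Qed.

Lemma spin_motion_disc i t : D (spin_motion i t).
Proof.
apply/nsq_disc; rewrite nsq_spin; apply/nsq_disc.
exact: (proj1 (hK (fiber_pt_fiber1 i))).
Qed.

Lemma is_motion_spin : is_motion K spin_motion.
Proof.
split.
- by move=> i; apply: continuous_subspaceT; exact: spin_motion_cont.
- by move=> i t _; exact: spin_motion_disc.
- by move=> i j t _; apply: contra_neq => /spin_inj/fiber_pt_inj.
- by rewrite fiber1E; congr image; apply/funext => i; rewrite spin_motion0.
- by rewrite fiber1E; congr image; apply/funext => i; rewrite spin_motion1.
Qed.

Lemma realizes_spin :
  realizes (fun t => spin (angle (a t) (b t))) spin_motion.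
Proof.
split.
- have c1 : continuous (@fst R C) by move=> p; exact: cvg_fst.
  have c2 : continuous (@snd R C) by move=> p; exact: cvg_snd.
  apply: continuous_subspaceT; apply: continuous_mul_expi => //.
  apply: continuous_angle => p.
  + exact: (continuous_comp (c1 p) (@ca p.1)).
  + exact: (continuous_comp (c1 p) (@cb p.1)).
  + exact: (continuous_comp (c2 p) (@continuous_nsq p.2)).
- by move=> t _; split; [exact: angle_disc_diffeo|exact: angle_circle].
- by move=> y _; rewrite a0 b0; apply: spin_fix; rewrite angle00 expi0.
- by move=> i t _; rewrite spin_motion0.
Qed.

Lemma induced_braid_spin : induced_braid spin_motion twist_braid.
Proof.
split; first exact: is_motion_spin.
exists (fun t => spin (angle (a t) (b t))); first exact: realizes_spin.
by exists twist_diffeo => // y _; rewrite a1 b1.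
Qed.

(* An induced braid depends only on the moving set, not on its labelling: the
   loops carried along by the spinning family avoid that set at every time. *)
Lemma induced_braid_unique n (m : 'I_n -> R -> C) (c : braid hK) :
  (forall t, 0 <= t <= 1 -> range (m ^~ t) = range (spin_motion ^~ t)) ->
  induced_braid m c -> c = twist_braid.
Proof.
move=> mE [mm [Dt rm [d dE ->]]].
apply/braid_classP/funext => x; rewrite -(pi1_reprK x); move: (pi1_repr x) => f.
rewrite !kdiffeo_pi1E; apply/pi1_classP.
pose L (p : R * R) := spin (angle (a p.1) (b p.1)) (f (clamp p.2)).
have LE t s : 0 <= s <= 1 -> L (t, s) = spin (angle (a t) (b t)) (f s).
  by move=> hs; rewrite /L /= clamp_id.
apply: (@loop_image_transport _ _ hK _ m Dt d f _ L) => //.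
- have cf : continuous (fun p : R * R => f (clamp p.2)).
    exact: path_clamp_cont (@cont_snd R).
  apply: continuous_subspaceT; apply: continuous_mul_expi => //.
  apply: continuous_angle => p.
  + exact: (continuous_comp (@cont_fst R p) (@ca p.1)).
  + exact: (continuous_comp (@cont_fst R p) (@cb p.1)).
  + exact: (continuous_comp (cf p) (@continuous_nsq (f (clamp p.2)))).
- move=> t s ht hs; rewrite LE //; have [Df nKf] := path_sub f hs.
  split; first by apply/nsq_disc; rewrite nsq_spin; exact/nsq_disc.
  move=> i miE; have : range (m ^~ t) (m i t) by exists i.
  rewrite mE // miE => -[k _ /spin_inj fE].
  by apply: nKf; rewrite -fE; exact: fiber_pt_fiber1.
- move=> s hs; rewrite !LE // a0 b0 a1 b1; split=> //.
  by apply: spin_fix; rewrite angle00 expi0.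
- move=> t ht; rewrite !LE ?lexx ?ler01 // path_src path_tgt.
  by rewrite angle_circle //; exact: circle_base.
Qed.

End Motion.

Lemma induced_braid_ext n (m m' : 'I_n -> R -> C) (c : braid hK) :
  (forall i t, 0 <= t <= 1 -> m i t = m' i t) ->
  induced_braid m c -> induced_braid m' c.
Proof.
move=> mE [[m1 m2 m3 m4 m5] [Dt [r1 r2 r3 r4] hd]].
have I0 : 0 <= (0 : R) <= 1 by rewrite lexx ler01.
have I1 : 0 <= (1 : R) <= 1 by rewrite lexx ler01.
split; last first.
  by exists Dt => //; split=> // i t ht; rewrite -!mE //; exact: r4.
split.
- move=> i; apply: (@subspace_eq_continuous _ _ _ (m i)); last exact: m1.
  by move=> t; rewrite inE /= in_itv; exact: mE.
- by move=> i t ht; rewrite -mE //; exact: m2.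
- by move=> i j t ht; rewrite -!mE //; exact: m3.
- by rewrite -m4; congr image; apply/funext => i; rewrite mE.
- by rewrite -m5; congr image; apply/funext => i; rewrite mE.
Qed.

End Spin.

(** * Action of the twist on the g-base *)

Section Action.
Variable R : realType.
Local Notation C := (cplx R).
Local Notation D := (@disc R).
Local Notation u0 := (base_pt R).
Local Notation K := (fiber (@curve R) 1).
Local Notation X := (D `\` K).
Local Notation hK := (@fiber1_sub R).
Local Notation hX := (punctured_base hK).
Local Notation loop := (pathIn R X u0 u0).
Local Notation inner_class := (pi1_class hX (connector_loop R (inord 4) (inord 1))).
Local Notation outer_class := (pi1_class hX (connector_loop R (inord 4) (inord 0))).

(* A full turn of |y| <= 1, dying out at |y| = 3/2. *)
Definition inner_angle (q : R) : R := 2 * pi * clamp (- (4 / 5) * q + 9 / 5).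

Lemma inner_angle_in q : q <= 1 -> inner_angle q = 2 * pi.
Proof. by move=> q1; rewrite /inner_angle clamp_ge1 ?mulr1 //; lra. Qed.

Lemma inner_angle_out q : 9 / 4 <= q -> inner_angle q = 0.
Proof. by move=> q1; rewrite /inner_angle clamp_le0 ?mulr0 //; lra. Qed.

Lemma continuous_inner_angle (U : topologicalType) (q : U -> R) :
  continuous q -> continuous (fun u => inner_angle (q u)).
Proof.
move=> cq u; apply: cvgM; first exact: cvg_cst.
exact: (@continuous_clamp_affine _ _ q).
Qed.

Lemma expi_inner_angle q : q = 1 \/ q = 4 -> expi (inner_angle q) = 1 :> C.
Proof.
by case=> ->; [rewrite inner_angle_in ?expi2pi|rewrite inner_angle_out ?expi0 //; lra].
Qed.

Section InnerLoop.
Variable f : loop.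

Lemma loop_nsq_cont : continuous (fun t : R => nsq (f (clamp t))).
Proof.
have cf : continuous (fun t : R => f (clamp t)) by exact: path_clamp_cont (@cont_id R).
by move=> t; exact: (continuous_comp (cf t) (@continuous_nsq R (f (clamp t)))).
Qed.

Lemma inner_cont : {within `[0, 1], continuous (spin inner_angle \o f)}.
Proof.
apply: (@within_eq _ R _ (fun t => spin inner_angle (f (clamp t)))).
  apply: continuous_mul_expi; first exact: path_clamp_cont (@cont_id R).
  by apply: continuous_inner_angle; exact: loop_nsq_cont.
by move=> t; rewrite /= in_itv => ht; rewrite clamp_id.
Qed.

Lemma inner_sub t : 0 <= t <= 1 -> X (spin inner_angle (f t)).
Proof.
by move=> ht; apply: spin_sub (path_sub f ht); apply: expi_inner_angle; [left|right].
Qed.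

Lemma inner_base : spin inner_angle u0 = u0.
Proof. by apply: spin_fix; rewrite nsq_base inner_angle_out ?expi0 //; lra. Qed.

Lemma inner_src : spin inner_angle (f 0) = u0.
Proof. by rewrite path_src inner_base. Qed.

Lemma inner_tgt : spin inner_angle (f 1) = u0.
Proof. by rewrite path_tgt inner_base. Qed.

Definition inner_loop : loop := PathIn inner_cont inner_sub inner_src inner_tgt.

(* Interpolating linearly from the twist to the inner twist followed by a full
   rigid rotation moves the base point once around the boundary circle. *)
Lemma twist_loop_class : pi1_class hX (loop_image hK (twist_diffeo R) f) =
  (outer_class * pi1_class hX inner_loop * outer_class^-1)%g.
Proof.
(* At q = 1 and q = 4 both ends of the interpolation have the angles 4 pi and 2 pi, so every stage
   fixes the fiber; at q = 16 the angle grows from 0 to 2 pi. *)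
pose th (s q : R) := (1 - s) * angle 1 1 q + s * (inner_angle q + 2 * pi).
pose H (p : R * R) : C := spin (th p.1) (f (clamp p.2)).
have HE s t : 0 <= t <= 1 -> H (s, t) = spin (th s) (f t).
  by move=> ht; rewrite /H /= clamp_id.
have I0 : 0 <= (0 : R) <= 1 by rewrite lexx ler01.
have I1 : 0 <= (1 : R) <= 1 by rewrite lexx ler01.
have cH : {within `[0, 1] `*` `[0, 1], continuous H}.
  have cq : continuous (fun p : R * R => nsq (f (clamp p.2))).
    by move=> p; exact: (continuous_comp (@cont_snd R p) (@loop_nsq_cont p.2)).
  apply: continuous_subspaceT; apply: continuous_mul_expi.
    exact: path_clamp_cont (@cont_snd R).
  move=> p; apply: cvgD; apply: cvgM.
  - by apply: cvgB; [exact: cvg_cst|exact: cvg_fst].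
  - by apply: (@continuous_angle _ _ (fun=> 1) (fun=> 1) _ _ _ cq) => q; exact: cvg_cst.
  - exact: cvg_fst.
  - apply: cvgD; last exact: cvg_cst.
    exact: (@continuous_inner_angle _ _ cq).
have [|||al alE ->] := @free_homotopy_class _ _ _ _ hX
    (loop_image hK (twist_diffeo R) f) inner_loop H cH.
- move=> s t hs ht; rewrite HE //; apply: spin_sub (path_sub f ht).
    rewrite /th angle1 inner_angle_in // -[RHS](expi_pi2n R 2); congr expi; ring.
  by rewrite /th angle4 inner_angle_out ?add0r; [rewrite -[RHS](expi_pi2n R 1);
    congr expi; ring|lra].
- move=> t ht; rewrite !HE // /th; split.
    by rewrite /spin subr0 mul1r mul0r addr0.
  by rewrite /= /spin subrr mul0r add0r mul1r expiD expi2pi mulr1.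
- by move=> s hs; rewrite !HE // path_src path_tgt.
have alT s : 0 <= s <= 1 ->
    al s = (4 * sin (2 * pi * s)) +i* (- (4 * cos (2 * pi * s))).
  move=> hs; rewrite alE // HE // path_src /spin nsq_base /th angle16.
  rewrite inner_angle_out; last by lra.
  rewrite mulr0 !add0r [s * _]mulrC /base_pt /expi.
  by apply/eqP; rewrite eq_complex /=; apply/andP; split; apply/eqP; ring.
suff -> : pi1_class hX al = outer_class by [].
apply/pi1_classP.
have q := @quadrants R.
(* On the two lateral arcs of |y| = 4 one has |Re y| >= 14/5, beyond all points of the fiber: these
   arcs lie in gaps 4 and 0. *)
apply: (@homotopic_connector_loop R _ _ al (1 / 8) (3 / 8) (5 / 8) (7 / 8)).
- lra.
- move=> t ht; rewrite alT /=; last lra.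
  have [/(_ (proj2 (andP ht)) (proj1 (andP ht))) h _ _ _ _] := q t; lra.
- move=> t ht; rewrite alT; last lra.
  have [_ /(_ ht) h _ _ _] := q t; split; rewrite inordK // => _ /=; lra.
- move=> t ht; rewrite alT /=; last lra.
  have [_ _ /(_ ht) h _ _] := q t; lra.
- move=> t ht; rewrite alT; last lra.
  have [_ _ _ /(_ ht) h _] := q t; split; rewrite inordK // => _ /=; lra.
- move=> t ht; rewrite alT /=; last lra.
  have [_ _ _ _ /(_ ht) h] := q t; lra.
Qed.

End InnerLoop.

Lemma gbase_loop_cases (i : 'I_4) (P : C -> Prop) t : 0 <= t <= 1 ->
  (forall s, 0 <= s <= 1 -> P (gbase_segment_fun i s)) ->
  (forall s, 0 <= s <= 1 -> P (gbase_circle_fun i s)) -> P (gbase_loop R i t).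
Proof.
move=> ht Ps Pc; rewrite gbase_loopE.
case: (leP t (1 / 4)) => h1; first by apply: Ps; lra.
by case: (leP t (1 / 2)) => h2; [apply: Pc|apply: Ps]; lra.
Qed.

(** [u] is the horizontal displacement from the centre a = i - 2, and 4/25 + a^2/100 is the squared
    radius. *)
Lemma nsq_gbase_circle (i : 'I_4) t : exists u : R,
  u ^+ 2 <= 4 / 25 + (i%:R - 2) ^+ 2 / 100 /\
  nsq (gbase_circle_fun i t) =
    (i%:R - 2) ^+ 2 + 2 * (i%:R - 2) * u + 4 / 25 + (i%:R - 2) ^+ 2 / 100.
Proof.
rewrite gbase_circle_coord /nsq /=; have cs := cos2Dsin2 (2 * pi * t : R).
move: (i%:R - 2) (cos _) (sin _) cs => a c s cs.
have : (2 / 5 * s - a / 10 * c) ^+ 2 + (2 / 5 * c + a / 10 * s) ^+ 2 =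
    (4 / 25 + a ^+ 2 / 100) * (c ^+ 2 + s ^+ 2) by field.
rewrite cs mulr1; move: (_ - _) (_ + a / 10 * s) => u v uv.
exists u; split; first by have := sqr_ge0 v; lra.
have -> : (a + u) ^+ 2 + (- v) ^+ 2 = a ^+ 2 + 2 * a * u + (u ^+ 2 + v ^+ 2) by ring.
by rewrite uv addrA.
Qed.

(** The loop around -2 avoids |y| < 3/2, so the inner twist leaves it alone. *)
Lemma gbase_loop_outside t : 0 <= t <= 1 -> 9 / 4 <= nsq (gbase_loop R ord0 t).
Proof.
move=> ht; apply: (@gbase_loop_cases _ (fun z => 9 / 4 <= nsq z)) => // s hs.
  (* The segment is nearest to the origin at s = 8/9. *)
  rewrite gbase_segment_coord /nsq /=; have := sqr_ge0 (9 * s - 8); lra.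
have [u [uu ->]] := nsq_gbase_circle ord0 s.
move: uu => /=; have := sqr_ge0 (u - 9 / 20); lra.
Qed.

(** The circles around -1, 0 and 1 stay in |y| < 3/2, so these loops leave that disc only on their
    segments. *)
Lemma gbase_loop_lower (i : 'I_4) t : i != ord0 -> 0 <= t <= 1 ->
  9 / 4 < nsq (gbase_loop R i t) -> complex.Im (gbase_loop R i t) < 0.
Proof.
move=> i0 ht;
  apply: (@gbase_loop_cases _ (fun z => 9 / 4 < nsq z -> complex.Im z < 0)) => // s hs.
  by move=> _; exact: gbase_segment_lower.
have [u [uu ->]] := nsq_gbase_circle i s.
have : (i%:R - 2 : R) ^+ 2 <= 1.
  by case: i i0 {uu} => -[|[|[|[|//]]]] /= _ // _; lra.
by move: (i%:R - 2) uu => a uu a1; have := sqr_ge0 (a - 2 * u); lra.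
Qed.

Lemma inner_gbase0 : pi1_class hX (inner_loop (gbase_loop R ord0)) = gbase R ord0.
Proof.
apply/pi1_classP; apply: homotopic_ext => t ht; apply: spin_fix.
by rewrite inner_angle_out ?expi0 //; exact: gbase_loop_outside.
Qed.

(* Fixes |y| <= 3/2 and maps 3/2 <= |y| <= 4 into 1 < |y| < 2. *)
Definition shrink (q : R) : R := 9 / (27 / 4 + Num.max (9 / 4) q).

Lemma shrink_in q : q <= 9 / 4 -> shrink q = 1.
Proof.
move=> q1; rewrite /shrink max_l //.
have -> : 27 / 4 + 9 / 4 = 9 :> R by lra.
by rewrite divff // pnatr_eq0.
Qed.

Lemma shrink_out q : 9 / 4 <= q -> shrink q = 9 / (27 / 4 + q).
Proof. by move=> q1; rewrite /shrink max_r. Qed.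

Lemma shrink_gt0 q : 0 < shrink q.
Proof.
apply: divr_gt0; first lra.
by apply: ltr_pwDl; rewrite ?le_max; lra.
Qed.

Lemma shrink_le1 q : shrink q <= 1.
Proof.
rewrite /shrink ler_pdivrMr ?mul1r.
  have : 9 / 4 <= Num.max (9 / 4) q by rewrite le_max lexx.
  lra.
by apply: ltr_pwDl; rewrite ?le_max; lra.
Qed.

(** The squared modulus becomes 81 q/(27/4 + q)^2, which is at most 3, reached at q = 27/4. In the
    annulus 1 < |y| < 2 a point can turn through any angle without meeting the fiber. *)
Lemma shrink_annulus q : 9 / 4 < q <= 16 -> 1 < shrink q ^+ 2 * q < 4.
Proof.
move=> /andP[q1 q2]; rewrite shrink_out ?(ltW q1) // expr_div_n mulrAC.
have p0 : 0 < (27 / 4 + q) ^+ 2 by apply: exprn_gt0; lra.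
rewrite ltr_pdivlMr // ltr_pdivrMr //; apply/andP; split.
  have : 0 < (q - 9 / 4) * (20 - q) by apply: mulr_gt0; lra.
  lra.
have := sqr_ge0 (q - 27 / 8); lra.
Qed.

Lemma continuous_shrink (U : topologicalType) (q : U -> R) :
  continuous q -> continuous (fun u => shrink (q u)).
Proof.
move=> cq u; apply: cvgM; first exact: cvg_cst.
apply: cvgV.
  apply/eqP => h; have := shrink_gt0 (q u).
  by rewrite /shrink h invr0 mulr0 ltxx.
apply: cvgD; first exact: cvg_cst.
by apply: (@continuous_max _ _ (fun=> 9 / 4) q u); [exact: cvg_cst|exact: cq].
Qed.

(* The base point is first brought to |y| < 2, then turned once around the
   three inner points while the inner twist is undone, and finally brought back. *)
Lemma inner_gbase (i : 'I_4) : i != ord0 ->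
  pi1_class hX (inner_loop (gbase_loop R i)) =
  (inner_class * gbase R i * inner_class^-1)%g.
Proof.
move=> i0; set f := gbase_loop R i.
(* Shrinking takes place in the first third of the time and is undone in the last; [rot] runs from 0
   to 1 in the middle third. *)
pose sg (s : R) : R := clamp (3 * s + 0) * clamp (- 3 * s + 3).
pose rot (s : R) : R := clamp (3 * s + (- 1)).
pose sc (s q : R) := 1 - sg s + sg s * shrink q.
(* When [rot s] reaches 1 the angle is 2 pi everywhere and the spin is the identity; on |y| <= 1 the
   angle is 2 pi all the time. *)
pose th (s q : R) := (1 - rot s) * inner_angle q + rot s * (2 * pi).
pose G (s : R) (y : C) : C := (sc s (nsq y))%:C * spin (th s) y.
pose H (p : R * R) : C := G p.1 (f (clamp p.2)).
have HE s t : 0 <= t <= 1 -> H (s, t) = G s (f t) by move=> ht; rewrite /H /= clamp_id.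
have I0 : 0 <= (0 : R) <= 1 by rewrite lexx ler01.
have I1 : 0 <= (1 : R) <= 1 by rewrite lexx ler01.
have sgE s : 1 / 3 <= s <= 2 / 3 -> sg s = 1 by move=> hs;
  rewrite /sg !clamp_ge1 ?mulr1; lra.
have rot0 s : s <= 1 / 3 -> rot s = 0 by move=> hs; rewrite /rot clamp_le0; lra.
have rot1 s : 2 / 3 <= s -> rot s = 1 by move=> hs; rewrite /rot clamp_ge1; lra.
have sg01 s : 0 <= sg s <= 1.
  have /andP[h1 h2] := clamp_itv (3 * s + 0);
    have /andP[h3 h4] := clamp_itv (- 3 * s + 3).
  by rewrite mulr_ge0 //= mulr_ile1.
have sc01 s q : 0 < sc s q <= 1.
  have := shrink_gt0 q; have := shrink_le1 q; have := sg01 s; rewrite /sc.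
  move: (sg s) (shrink q) => a b ha b1 b0.
  have : 0 <= a * (1 - b) by apply: mulr_ge0; lra.
  have : 0 <= (1 - a) * (1 - b) by apply: mulr_ge0; lra.
  lra.
have cH : {within `[0, 1] `*` `[0, 1], continuous H}.
  have cq : continuous (fun p : R * R => nsq (f (clamp p.2))).
    by move=> p; exact: (continuous_comp (@cont_snd R p) (@loop_nsq_cont f p.2)).
  have cclamp (a b : R) : continuous (fun p : R * R => clamp (a * p.1 + b)).
    exact: continuous_clamp_affine (@cont_fst R).
  have csg : continuous (fun p : R * R => sg p.1).
    by move=> p; apply: cvgM; exact: cclamp.
  have crot : continuous (fun p : R * R => rot p.1) by exact: cclamp.
  apply: continuous_subspaceT => p; apply: cvgM.
    apply: (@continuous_complex _ _ (fun p : R * R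
      => sc p.1 (nsq (f (clamp p.2)))) (fun=> 0)).
      move=> {}p; apply: cvgD; first by apply: cvgB; [exact: cvg_cst|exact: csg].
      by apply: cvgM; [exact: csg|exact: (@continuous_shrink _ _ cq)].
    by move=> q; exact: cvg_cst.
  apply: (@continuous_mul_expi R _ (fun p : R * R => f (clamp p.2))
    (fun p => th p.1 (nsq (f (clamp p.2)))));
      first exact: path_clamp_cont (@cont_snd R).
  move=> {}p; apply: cvgD; apply: cvgM.
  - by apply: cvgB; [exact: cvg_cst|exact: crot].
  - exact: (@continuous_inner_angle _ _ cq).
  - exact: crot.
  - exact: cvg_cst.
have nsqG s y : nsq (G s y) = sc s (nsq y) ^+ 2 * nsq y.
  by rewrite /G nsqM nsqR nsq_spin.
have GX s t : 0 <= s <= 1 -> 0 <= t <= 1 -> X (G s (f t)).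
  move=> hs ht; have [Dy nKy] := path_sub f ht; have lowy := gbase_loop_lower i0 ht.
  rewrite -/f in lowy; move: (f t) Dy nKy lowy => y Dy nKy lowy.
  move/nsq_disc in Dy; have y0 := nsq_ge0 y.
  have /andP[k0 k1] := sc01 s (nsq y); split.
    apply/nsq_disc; rewrite nsqG; apply: le_trans Dy.
    by rewrite ler_piMl // expr_le1 // ltW.
  (* Inside |y| <= 3/2 nothing is shrunk, and 0 and |y| = 1 are fixed pointwise, so a point landing
     in the fiber was there already. *)
  move=> KG; have [q1|q1] := leP (nsq y) (9 / 4).
    have kE : sc s (nsq y) = 1 by rewrite /sc shrink_in // mulr1 subrK.
    have GE : G s y = spin (th s) y by rewrite /G kE mul1r.
    apply: nKy; suff <- : G s y = y by [].
    rewrite GE; have [/eqP|n1|n4] := nsq_fiber1 KG.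
    - rewrite GE /spin mulf_eq0 (negbTE (expi_neq0 _)) orbF => /eqP ->.
      by rewrite mul0r.
    - have {}n1 : nsq y = 1 by rewrite -n1 GE nsq_spin.
      apply: spin_fix; rewrite n1 /th inner_angle_in //.
      by rewrite -mulrDl subrK mul1r expi2pi.
    - by exfalso; move: n4; rewrite GE nsq_spin; lra.
  have thE : th s (nsq y) = rot s * (2 * pi).
    by rewrite /th inner_angle_out ?mulr0 ?add0r // ltW.
  (* With [rot s] equal to 0 or 1 the point is only scaled by a positive real, and stays in the
     lower half plane by [gbase_loop_lower]. *)
  have low : rot s = 0 \/ rot s = 1 -> False.
    move=> r01; have e1 : spin (th s) y = y.
      apply: spin_fix; rewrite thE; case: r01 => ->; first by rewrite mul0r expi0.
      by rewrite mul1r expi2pi.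
    apply: (@not_fiber1 R (G s y)) => //; left; rewrite /G e1.
    have -> : complex.Im ((sc s (nsq y))%:C * y) = sc s (nsq y) * complex.Im y.
      by case: (y) => a b /=; ring.
    by apply: mulf_neq0; [rewrite gt_eqF|rewrite lt_eqF // lowy].
  have [h1|h1] := leP s (1 / 3); first by apply: low; left; exact: rot0.
  have [h2|h2] := leP (2 / 3) s; first by apply: low; right; exact: rot1.
  have kE : sc s (nsq y) = shrink (nsq y).
    by rewrite /sc sgE ?subrr ?add0r ?mul1r //; lra.
  have := @shrink_annulus (nsq y); rewrite -kE -nsqG => h.
  have {}h : 1 < nsq (G s y) < 4 by apply: h; lra.
  move: h; case: (nsq_fiber1 KG) => [->|->|->]; rewrite ?ltxx ?andbF //.
  by rewrite /nsq /= expr0n addr0 ltr10.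
have [|||al alE ->] := @free_homotopy_class _ _ _ _ hX (inner_loop f) f H cH.
- by move=> s t hs ht; rewrite HE //; exact: GX.
- move=> t ht; rewrite !HE // /G /sc /spin /th rot0 ?rot1; [|lra|lra].
  have -> : sg 0 = 0 by rewrite /sg clamp_le0 ?mul0r //; lra.
  have -> : sg 1 = 0 by rewrite /sg (@clamp_le0 _ (- 3 * 1 + 3)) ?mulr0 //; lra.
  rewrite !subr0 !mul0r !addr0 !mul1r subrr mul0r add0r expi2pi mulr1.
  by split.
- by move=> s hs; rewrite !HE // path_src path_tgt.
have alT s : 0 <= s <= 1 -> al s = (4 * sc s 16 * sin (2 * pi * rot s)) +i*
    (- (4 * sc s 16 * cos (2 * pi * rot s))).
  move=> hs; rewrite alE // HE // path_src /G /spin nsq_base /th inner_angle_out;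
    last by lra.
  rewrite mulr0 !add0r [rot s * _]mulrC /base_pt /expi.
  by apply/eqP; rewrite eq_complex /=; apply/andP; split; apply/eqP; ring.
suff -> : pi1_class hX al = inner_class by [].
apply/pi1_classP.
have q := @quadrants R.
have rotE s : 1 / 3 <= s <= 2 / 3 -> rot s = 3 * s - 1.
  by move=> hs; rewrite /rot clamp_id; lra.
(* 36/91 is [shrink 16]: the base point circles at radius 144/91. As 144/91 times 7/10 exceeds 1
   while 144/91 is less than 2, it crosses in gaps 4 and 1. *)
have scE s : 1 / 3 <= s <= 2 / 3 -> sc s 16 = 36 / 91.
  by move=> hs; rewrite /sc sgE // shrink_out; [field|lra].
have sc0 s := sc01 s 16.
have rot01 s : 0 <= rot s <= 1 by exact: clamp_itv.
(* [rot t] = 3t - 1 equals 1/8, 3/8, 5/8, 7/8 at these times. *)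
apply: (@homotopic_connector_loop R _ _ al (3 / 8) (11 / 24) (13 / 24) (5 / 8)).
- lra.
- move=> t ht; rewrite alT /=; last lra.
  have r8 : rot t <= 1 / 8.
    by have [h|h] := leP t (1 / 3); [rewrite rot0; lra|rewrite rotE; lra].
  have [/(_ r8 (proj1 (andP (rot01 t)))) h _ _ _ _] := q (rot t).
  by rewrite oppr_lt0; apply: mulr_gt0; [have := sc0 t|]; lra.
- move=> t ht; rewrite alT; last lra.
  rewrite scE ?rotE; [|lra|lra].
  have [_ h _ _ _] := q (3 * t - 1); have {}h := h ltac:(lra).
  by split; rewrite inordK // => _ /=; lra.
- move=> t ht; rewrite alT /=; last lra.
  rewrite scE ?rotE; [|lra|lra].
  have [_ _ h _ _] := q (3 * t - 1); have {}h := h ltac:(lra).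
  lra.
- move=> t ht; rewrite alT; last lra.
  rewrite scE ?rotE; [|lra|lra].
  have [_ _ _ h _] := q (3 * t - 1); have {}h := h ltac:(lra).
  have := cos2Dsin2 (2 * pi * (3 * t - 1)); move: h.
  move: (cos _) (sin _) => c s h cs.
  have : - 1 <= s by have := sqr_ge0 c; nra.
  by split; rewrite inordK // => _ /=; lra.
- move=> t ht; rewrite alT /=; last lra.
  have r8 : 7 / 8 <= rot t <= 1.
    rewrite (proj2 (andP (rot01 t))) andbT.
    by have [h|h] := leP (2 / 3) t; [rewrite rot1; lra|rewrite rotE; lra].
  have [_ _ _ _ /(_ r8) h] := q (rot t).
  by rewrite oppr_lt0; apply: mulr_gt0; [have := sc0 t|]; lra.
Qed.

Lemma twist_braid_gbase (i : 'I_4) :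
  let A := (gbase R (inord 3) * gbase R (inord 2) * gbase R (inord 1))%g in
  let T := (A * gbase R (inord 0))%g in
  braid_act (twist_braid R) (gbase R i) =
    if i == ord0 then (T * gbase R i * T^-1)%g
    else (T * (A * gbase R i * A^-1) * T^-1)%g.
Proof.
move=> A T; have TE : T = outer_class by rewrite /T /A gbase_prod_outer.
have AE : A = inner_class by rewrite /A gbase_prod_inner.
rewrite /twist_braid braid_act_class kdiffeo_pi1E twist_loop_class -TE.
by case: eqVneq => [->|i0]; rewrite ?inner_gbase0 // inner_gbase // -AE.
Qed.

End Action.

(** * The two motions *)

Section Monodromy.
Variable R : realType.
Local Notation C := (cplx R).
Local Notation K := (fiber (@curve R) 1).

Lemma spin_motionE (a b : R -> R) (i : 'I_4) t : spin_motion a b i t =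
  if i == ord0 then fiber_pt R i * expi (2 * pi * b t)
  else fiber_pt R i * expi (4 * pi * a t).
Proof.
rewrite /spin_motion /spin nsq_fiber_pt; case: i => -[|[|[|[|//]]]] hi /=.
- have -> : (0%:R - 2 : R) ^+ 2 = 4 by ring.
  by rewrite angle4.
- have -> : (1%:R - 2 : R) ^+ 2 = 1 by ring.
  by rewrite angle1.
- by rewrite /fiber_pt /= subrr !mul0r.
- have -> : (3%:R - 2 : R) ^+ 2 = 1 by ring.
  by rewrite angle1.
Qed.

Lemma fiber_ptE : [/\ fiber_pt R (inord 0) = - 2, fiber_pt R (inord 1) = - 1,
  fiber_pt R (inord 2) = 0 & fiber_pt R (inord 3) = 1].
Proof.
by rewrite /fiber_pt !inordK //; split; apply/eqP; rewrite eq_complex /=;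
  apply/andP; split; apply/eqP; lra.
Qed.

(** Over |x| = 1 the fiber consists of 0, -2x, x^2 and -x^2: as x turns once, -2 turns once and 1,
    -1 turn twice. *)
Lemma unit_fiberE t : fiber (@curve R) (expi (2 * pi * t)) =
  range (spin_motion (@id R) (@id R) ^~ t).
Proof.
set x := expi (2 * pi * t).
have x2 : expi (4 * pi * t) = x ^+ 2 :> C.
  by rewrite expr2 /x -expiD; congr expi; ring.
have [p0 p1 p2 p3] := fiber_ptE.
have m0 : spin_motion id id (inord 0) t = - 2 * x.
  by rewrite spin_motionE p0 ifT // -val_eqE /= inordK.
have mE (k : nat) : (0 < k < 4)%N ->
    spin_motion id id (inord k) t = fiber_pt R (inord k) * x ^+ 2.
  move=> /andP[k0 k4]; rewrite spin_motionE -x2 ifF //.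
  by rewrite -val_eqE /= inordK // gtn_eqF.
apply/seteqP; split=> y.
  move=> [_ [_ /= /eqP]]; rewrite !mulf_eq0 -!orbA => /or4P[] /eqP h.
  - by exists (inord 2) => //; rewrite mE // p2 mul0r.
  - exists (inord 0) => //; rewrite m0; apply/eqP; rewrite eq_sym -subr_eq0.
    by rewrite -[X in _ == X]h; apply/eqP; ring.
  - exists (inord 1) => //; rewrite mE // p1; apply/eqP; rewrite eq_sym -subr_eq0.
    by rewrite -[X in _ == X]h; apply/eqP; ring.
  - exists (inord 3) => //; rewrite mE // p3; apply/eqP; rewrite eq_sym -subr_eq0.
    by rewrite -[X in _ == X]h; apply/eqP; ring.
move=> [i _ <-]; split.
  rewrite /unit_disc /= normc_def -[X in Num.sqrt X]/(nsq x) nsq_expi sqrtr1.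
  exact: lexx.
split; first exact: spin_motion_disc.
case: i => -[|[|[|[|//]]]] hi.
- have -> : Ordinal hi = inord 0 by apply/val_inj; rewrite /= inordK.
  by rewrite /= m0; ring.
- have -> : Ordinal hi = inord 1 by apply/val_inj; rewrite /= inordK.
  by rewrite /= mE // p1; ring.
- have -> : Ordinal hi = inord 2 by apply/val_inj; rewrite /= inordK.
  by rewrite /= mE // p2; ring.
- have -> : Ordinal hi = inord 3 by apply/val_inj; rewrite /= inordK.
  by rewrite /= mE // p3; ring.
Qed.

(** The number and labelling of the moving points are arbitrary in [is_local_monodromy];
    [induced_braid_unique] compares only the moving sets. *)
Lemma local_monodromyP (b : braid (@fiber1_sub R)) :
  is_local_monodromy b <-> b = twist_braid R.
Proof.
split=> [[n [m [mE]]]|->].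
  apply: (@induced_braid_unique R id id (@cont_id R) (@cont_id R)) => //.
  by move=> t ht; rewrite mE // unit_fiberE.
exists 4%N, (spin_motion id id); split=> [t _|]; first by rewrite unit_fiberE.
exact: (@induced_braid_spin R id id (@cont_id R) (@cont_id R)).
Qed.

Definition first_half (t : R) : R := clamp (2 * t + 0).
Definition second_half (t : R) : R := clamp (2 * t + (- 1)).

Lemma twist_motion_spin (i : 'I_4) t : 0 <= t <= 1 ->
  spin_motion first_half second_half i t = twist_motion i t.
Proof.
move=> ht; rewrite spin_motionE /twist_motion /first_half /second_half addr0.
case: (leP t 2^-1) => h.
  by rewrite (@clamp_id _ (2 * t)) ?(@clamp_le0 _ (2 * t + _)) ?mulr0 ?expi0
    ?mulr1 //; lra.
rewrite (@clamp_ge1 _ (2 * t)) ?(@clamp_id _ (2 * t + _)); [|lra|lra].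
(* The first stage ends after two whole turns, so in the second stage the inner points rest at their
   initial places. *)
rewrite mulr1 -[4 * pi](_ : 2 * pi * 2 = _); last by ring.
by rewrite expi_pi2n mulr1.
Qed.

(** The ramps run from 0 to 1 like the identity law of the monodromy, so the final spin is again
    [twist_diffeo]. *)
Lemma twist_motionP (b : braid (@fiber1_sub R)) :
  induced_braid (@twist_motion R) b <-> b = twist_braid R.
Proof.
have cE (c : R) : continuous (fun t : R => clamp (2 * t + c)).
  exact: continuous_clamp_affine (@cont_id R).
have c1 : continuous first_half by exact: cE.
have c2 : continuous second_half by exact: cE.
have e10 : first_half 0 = 0 by rewrite /first_half clamp_le0 //; lra.
have e20 : second_half 0 = 0 by rewrite /second_half clamp_le0 //; lra.
have e11 : first_half 1 = 1 by rewrite /first_half clamp_ge1 //; lra.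
have e21 : second_half 1 = 1 by rewrite /second_half clamp_ge1 //; lra.
split=> [|->].
  apply: (induced_braid_unique c1 c2 e10 e20 e11 e21) => t ht.
  by congr image; apply/funext => i; rewrite twist_motion_spin.
apply: induced_braid_ext (induced_braid_spin c1 c2 e10 e20 e11 e21) => i t.
exact: twist_motion_spin.
Qed.

Lemma twist_braid_relations (p : pi1 R (punctured_base (@fiber1_sub R)) *
    pi1 R (punctured_base (@fiber1_sub R))) :
  let A := (gbase R (inord 3) * gbase R (inord 2) * gbase R (inord 1))%g in
  let T := (A * gbase R (inord 0))%g in
  induced_relations (gbase R) (twist_braid R) p <->
    p = (T * gbase R (inord 0) * T^-1, gbase R (inord 0))%g \/
    exists2 j : 'I_4, j != ord0 &
      p = (T * (A * gbase R j * A^-1) * T^-1, gbase R j)%g.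
Proof.
move=> A T; have i0 : inord 0 = ord0 :> 'I_4 by apply/val_inj; rewrite /= inordK.
split=> [[j _ <-]|[->|[j j0 ->]]].
- rewrite twist_braid_gbase; case: eqVneq => [->|j0]; first by left; rewrite -i0.
  by right; exists j.
- by exists (inord 0) => //; rewrite twist_braid_gbase i0 eqxx -i0.
- by exists j => //; rewrite twist_braid_gbase (negbTE j0).
Qed.

End Monodromy.

Theorem theorem5p1 (R : realType) :
  exists beta : braid (@fiber1_sub R),
    [/\ forall b, is_local_monodromy b <-> b = beta,
        forall b, induced_braid (@twist_motion R) b <-> b = beta &
        let x1 := gbase R (inord 0) in
        let x2 := gbase R (inord 1) in
        let x3 := gbase R (inord 2) in
        let x4 := gbase R (inord 3) in
        same_relations (induced_relations (gbase R) beta)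
          [set (x1 * x4 * x3 * x2, x4 * x3 * x2 * x1)%g;
               ((x4 * x3 * x2) ^+ 2 * x1,
                x3 * x2 * x4 * x3 * x2 * x1 * x4)%g;
               (x3 * x2 * x4 * x3 * x2 * x1 * x4,
                x2 * x4 * x3 * x2 * x1 * x4 * x3)%g]].
Proof.
exists (twist_braid R); split; [exact: local_monodromyP|exact: twist_motionP|].
by move=> x1 x2 x3 x4; apply: twist_same_relations => p; exact: twist_braid_relations.
Qed.
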